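(* Let $E(q)=\prod_{k\ge1}(1-q^k)$ and define $g(n)$ by $\sum_{n\ge0}g(n)q^n=\frac{E(q^2)^5}{E(q)^4}$. Then for all $\alpha\ge1$ and $n\ge0$, $$g\left(3^{2\alpha-1}n+\frac{3^{2\alpha}-1}{4}\right)\equiv0\pmod{3^{2\alpha}}.$$ *)

(* Defs.v *)
From mathcomp Require Import all_boot all_order all_algebra.
Set Implicit Arguments. Unset Strict Implicit. Unset Printing Implicit Defensive.
Import GRing.Theory.
Local Open Scope ring_scope.

(* Truncation of E(q) = prod_{k>=1} (1 - q^k) to the factors k <= N.
   Its coefficients of degree <= N agree with those of E(q). *)
Definition Etrunc (N : nat) : {poly int} :=
  \prod_(1 <= k < N.+1) (1 - 'X^k).

(* Truncation of 1/E(q) = prod_{k>=1} 1/(1-q^k) = prod_{k>=1} sum_{j>=0} q^(k j);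
   coefficients of degree <= N agree with those of 1/E(q). *)
Definition Einvtrunc (N : nat) : {poly int} :=
  \prod_(1 <= k < N.+1) \sum_(j < N.+1) 'X^(k * j).

Definition g (n : nat) : int :=
  (((Etrunc n \Po 'X^2) ^+ 5) * (Einvtrunc n ^+ 4))`_n.

(* Main.v *)
Require Import Defs.
From HB Require Import structures.
From mathcomp Require Import all_boot all_order all_algebra.
From mathcomp Require Import boolp.
From mathcomp Require Import zify ring.
Set Implicit Arguments. Unset Strict Implicit. Unset Printing Implicit Defensive.
Import Order.TTheory GRing.Theory Num.Theory.
Local Open Scope ring_scope.

(* Write [phi(q) = sum_n (-1)^n q^(n^2) = E(q)^2 / E(q^2)] and
   [psi(q) = sum_(n >= 0) q^(n (n + 1) / 2) = E(q^2)^2 / E(q)], so that the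
   generating function of [g] is [F = psi^2 / phi]; put [G = F(q^3)] and
   [T = phi(q^3)^4 / phi(q)^4].  The triple product gives the 3-dissections
   [phi = phi(q^9) - 2 q B(q^3)] and [psi = A(q^3) + q psi(q^9)] with
   [A B = psi(q^3) phi(q^3)], and the product of [phi(w q)] over the cube roots
   of unity [w] gives [phi^4 = phi(q^3) (phi(q^3)^3 - 8 q B^3)].  Hence
   [rho = phi(q^9) / phi] satisfies the cubic
   [rho^3 = T(q^3) (3 rho^2 - 3 rho + 1)], so extracting the exponents congruent
   to 2 (resp. 0) mod 3 maps [F Z[T]] into [G Z[T]] (resp. [G Z[T]] into
   [F Z[T]]), with coefficients given by a three-term recurrence whose 3-adic
   valuations are easily bounded.  Alternating the two operators therefore gains
   a factor 9 in every round, starting from [G * 9 T]. *)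

(** * Formal power series over the integers *)

Record fps := Fps { fcoef : nat -> int }.

Notation "f .[: n ]" := (fcoef f n) (at level 2, n at level 200, format "f .[: n ]").

HB.instance Definition _ := gen_eqMixin fps.
HB.instance Definition _ := gen_choiceMixin fps.

Lemma fpsP (f g : fps) : (forall n, f.[:n] = g.[:n]) -> f = g.
Proof. by case: f g => [f] [g] /= fg; congr Fps; apply: funext. Qed.

Definition fps_add f g := Fps (fun n => f.[:n] + g.[:n]).
Definition fps_opp f := Fps (fun n => - f.[:n]).
Definition fps_const c := Fps (fun n => if n is 0 then c else 0).
Definition fps_mul f g := Fps (fun n => \sum_(i < n.+1) f.[:i] * g.[:n - i]).

Definition ftrunc n f : {poly int} := \poly_(i < n.+1) f.[:i].

Lemma coef_ftrunc n f i : (i <= n)%N -> (ftrunc n f)`_i = f.[:i].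
Proof. by move=> le_in; rewrite coef_poly ltnS le_in. Qed.

(** Coefficient [n] of a product involves no coefficient beyond [n], so associativity and
    commutativity of [fps_mul] are inherited from polynomials. *)
Lemma fps_mul_trunc f g N n (p q : {poly int}) : (n <= N)%N ->
  (forall i, (i <= N)%N -> p`_i = f.[:i]) ->
  (forall i, (i <= N)%N -> q`_i = g.[:i]) ->
  (p * q)`_n = (fps_mul f g).[:n].
Proof.
move=> nN pf qg; rewrite coefM; apply: eq_bigr => i _.
by rewrite pf ?qg //; have := ltn_ord i; lia.
Qed.

Fact fps_addA : associative fps_add.
Proof. by move=> f g h; apply: fpsP => n /=; rewrite addrA. Qed.
Fact fps_addC : commutative fps_add.
Proof. by move=> f g; apply: fpsP => n /=; rewrite addrC. Qed.
Fact fps_add0 : left_id (fps_const 0) fps_add.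
Proof. by move=> f; apply: fpsP => -[|n] /=; rewrite add0r. Qed.
Fact fps_addN : left_inverse (fps_const 0) fps_opp fps_add.
Proof. by move=> f; apply: fpsP => -[|n] /=; rewrite addNr. Qed.

HB.instance Definition _ :=
  GRing.isZmodule.Build fps fps_addA fps_addC fps_add0 fps_addN.

Fact fps_mulA : associative fps_mul.
Proof.
move=> f g h; apply: fpsP => n.
rewrite -(@fps_mul_trunc _ _ n n (ftrunc n f) (ftrunc n g * ftrunc n h)) //.
- rewrite -(@fps_mul_trunc _ _ n n (ftrunc n f * ftrunc n g) (ftrunc n h)) //.
  + by rewrite mulrA.
  + by move=> i le_in; apply: (@fps_mul_trunc _ _ n) => // *; apply: coef_ftrunc.
  + by move=> *; apply: coef_ftrunc.
- by move=> *; apply: coef_ftrunc.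
- by move=> i le_in; apply: (@fps_mul_trunc _ _ n) => // *; apply: coef_ftrunc.
Qed.

Fact fps_mulC : commutative fps_mul.
Proof.
move=> f g; apply: fpsP => n.
rewrite -(@fps_mul_trunc _ _ n n (ftrunc n f) (ftrunc n g)) //; try exact: coef_ftrunc.
by rewrite mulrC (@fps_mul_trunc g f n) //; exact: coef_ftrunc.
Qed.

Fact fps_mul1 : left_id (fps_const 1) fps_mul.
Proof.
move=> f; apply: fpsP => n /=; rewrite big_ord_recl /= mul1r subn0 big1 ?addr0 //.
by move=> i _; rewrite mul0r.
Qed.

Fact fps_mulDl : left_distributive fps_mul fps_add.
Proof.
move=> f g h; apply: fpsP => n /=; rewrite -big_split /=.
by apply: eq_bigr => i _; rewrite mulrDl.
Qed.

Fact fps_1neq0 : fps_const 1 != 0.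
Proof. by apply/eqP => /(congr1 (fun f => f.[:0])). Qed.

HB.instance Definition _ := GRing.Zmodule_isComNzRing.Build fps
  fps_mulA fps_mulC fps_mul1 fps_mulDl fps_1neq0.

(** Invertibility is decided classically and the inverse is picked by choice; this makes [phi^-1]
    available as a ring inverse. *)
Definition fps_unit (f : fps) := `[< exists h, h * f = 1 >].
Definition fps_inv (f : fps) :=
  if pselect (exists h, h * f = 1) is left fu then projT1 (cid fu) else f.

Fact fps_mulVf : {in fps_unit, left_inverse 1 fps_inv *%R}.
Proof.
move=> f /asboolP fu; rewrite /fps_inv; case: pselect => // fu'.
by case: cid.
Qed.
Fact fps_unitP (f h : fps) : h * f = 1 -> fps_unit f.
Proof. by move=> hf; apply/asboolP; exists h. Qed.
Fact fps_inv_out : {in [predC fps_unit], fps_inv =1 id}.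
Proof.
by move=> f /asboolP fu; rewrite /fps_inv; case: pselect.
Qed.

HB.instance Definition _ := GRing.ComNzRing_hasMulInverse.Build fps
  fps_mulVf fps_unitP fps_inv_out.

Lemma fcoefD f g n : (f + g).[:n] = f.[:n] + g.[:n]. Proof. by []. Qed.
Lemma fcoefN f n : (- f).[:n] = - f.[:n]. Proof. by []. Qed.
Lemma fcoefB f g n : (f - g).[:n] = f.[:n] - g.[:n]. Proof. by []. Qed.
Lemma fcoef0 n : (0 : fps).[:n] = 0. Proof. by case: n. Qed.
Lemma fcoef1 n : (1 : fps).[:n] = (n == 0%N)%:R. Proof. by case: n. Qed.
Lemma fcoefM f g n : (f * g).[:n] = \sum_(i < n.+1) f.[:i] * g.[:n - i].
Proof. by []. Qed.
Lemma fcoefMn f n k : (f *+ k).[:n] = f.[:n] *+ k.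
Proof. by elim: k => [|k IH]; rewrite ?mulr0n ?fcoef0 // !mulrS fcoefD IH. Qed.
Lemma fcoefMz f n (k : int) : (f *~ k).[:n] = k * f.[:n].
Proof.
have fMn m : (f *+ m).[:n] = m%:Z * f.[:n] by rewrite fcoefMn -mulr_natl natz.
case: k => k; first exact: fMn.
by rewrite NegzE mulrNz fcoefN mulNr -fMn.
Qed.
Lemma fcoef_sum (I : Type) (r : seq I) (P : pred I) (F : I -> fps) n :
  (\sum_(i <- r | P i) F i).[:n] = \sum_(i <- r | P i) (F i).[:n].
Proof. by apply: (big_morph (fun f => f.[:n]) _ (fcoef0 n)). Qed.

Lemma fcoefM0 f g : (f * g).[:0] = f.[:0] * g.[:0].
Proof. by rewrite fcoefM big_ord1. Qed.

Lemma fcoefX0 f n : (f ^+ n).[:0] = f.[:0] ^+ n.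
Proof. by elim: n => [|n IH]; rewrite ?expr0 // !exprS fcoefM0 IH. Qed.

(** * Congruence modulo [q ^ n] *)

Definition eqmodX n (f g : fps) := forall i, (i < n)%N -> f.[:i] = g.[:i].

Notation "f = g %[modX n ]" := (eqmodX n f g)
  (at level 70, g at next level, format "f  =  g  %[modX  n ]").

Lemma eqmodXP f g : (forall n, f = g %[modX n]) -> f = g.
Proof. by move=> fg; apply: fpsP => n; apply: (fg n.+1). Qed.

Lemma eqmodX_refl n f : f = f %[modX n]. Proof. by []. Qed.
Hint Resolve eqmodX_refl : core.
Lemma eqmodX_sym n f g : f = g %[modX n] -> g = f %[modX n].
Proof. by move=> fg i lt_in; rewrite fg. Qed.
Lemma eqmodX_trans n g f h :
  f = g %[modX n] -> g = h %[modX n] -> f = h %[modX n].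
Proof. by move=> fg gh i lt_in; rewrite fg ?gh. Qed.
Lemma eqmodXW m n f g : (m <= n)%N -> f = g %[modX n] -> f = g %[modX m].
Proof. by move=> le_mn fg i lt_im; apply: fg; apply: leq_trans le_mn. Qed.
Lemma eqmodXD n f f' g g' : f = f' %[modX n] -> g = g' %[modX n] ->
  f + g = f' + g' %[modX n].
Proof. by move=> ff' gg' i lt_in; rewrite !fcoefD ff' ?gg'. Qed.
Lemma eqmodXN n f f' : f = f' %[modX n] -> - f = - f' %[modX n].
Proof. by move=> ff' i lt_in; rewrite !fcoefN ff'. Qed.
Lemma eqmodXM n f f' g g' : f = f' %[modX n] -> g = g' %[modX n] ->
  f * g = f' * g' %[modX n].
Proof.
move=> ff' gg' i lt_in; rewrite !fcoefM; apply: eq_bigr => j _.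
by rewrite ff' ?gg' //; have := ltn_ord j; lia.
Qed.
Lemma eqmodX_exp n f f' k : f = f' %[modX n] -> f ^+ k = f' ^+ k %[modX n].
Proof. by move=> ff'; elim: k => [|k IH]; rewrite ?expr0 // !exprS; apply: eqmodXM. Qed.
Lemma eqmodX_sum n (I : eqType) (r : seq I) (P : pred I) (F G : I -> fps) :
  (forall i, i \in r -> P i -> F i = G i %[modX n]) ->
  \sum_(i <- r | P i) F i = \sum_(i <- r | P i) G i %[modX n].
Proof.
move=> FG; rewrite big_seq_cond [X in eqmodX _ _ X]big_seq_cond.
apply: (big_ind2 (eqmodX n)) => // [f f' g g'|i /andP[ri Pi]]; first exact: eqmodXD.
exact: FG.
Qed.
Lemma eqmodX_prod n (I : eqType) (r : seq I) (P : pred I) (F G : I -> fps) :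
  (forall i, i \in r -> P i -> F i = G i %[modX n]) ->
  \prod_(i <- r | P i) F i = \prod_(i <- r | P i) G i %[modX n].
Proof.
move=> FG; rewrite big_seq_cond [X in eqmodX _ _ X]big_seq_cond.
apply: (big_ind2 (eqmodX n)) => // [f f' g g'|i /andP[ri Pi]]; first exact: eqmodXM.
exact: FG.
Qed.

Definition fX : fps := Fps (fun n => (n == 1%N)%:R).
Notation "''q'" := fX.

Lemma fcoef_qM f n : ('q * f).[:n] = if n is n'.+1 then f.[:n'] else 0.
Proof.
rewrite fcoefM; case: n => [|n]; first by rewrite big_ord1 mul0r.
rewrite big_ord_recl mul0r add0r big_ord_recl /= mul1r subSS subn0.
by rewrite big1 ?addr0 // => i _; rewrite mul0r.
Qed.

Lemma fcoef_qXM f k n : ('q ^+ k * f).[:n] = if (n < k)%N then 0 else f.[:n - k].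
Proof.
elim: k n => [|k IH] n; first by rewrite expr0 mul1r subn0.
rewrite exprS -mulrA fcoef_qM; case: n => [|n]; by rewrite // IH ltnS subSS.
Qed.

Lemma fcoef_qX k n : ('q ^+ k).[:n] = (n == k)%:R.
Proof.
rewrite -[_ ^+ _]mulr1 fcoef_qXM fcoef1; case: ltngtP => [||->]; rewrite ?subnn //.
by rewrite -subn_gt0; case: (_ - _)%N.
Qed.

Lemma eqmodX_qX n k f : (n <= k)%N -> 'q ^+ k * f = 0 %[modX n].
Proof. by move=> le_nk i lt_in; rewrite fcoef_qXM fcoef0 (leq_trans lt_in le_nk). Qed.

Lemma fcoef0_eq0_exp (h : fps) k n : h.[:0] = 0 -> (n < k)%N -> (h ^+ k).[:n] = 0.
Proof.
move=> h0; elim: k n => // k IH n; rewrite ltnS => le_nk.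
rewrite exprS fcoefM big_ord_recl h0 mul0r add0r big1 // => i _.
by rewrite lift0 IH ?mulr0 //; move: i => [i lt_in] /=; lia.
Qed.

(** The inverse is the geometric series in [1 - f]; its partial sums stabilise because
    [(1 - f) ^+ k] starts in degree at least [k]. *)
Lemma fps_unit_geom (f : fps) : f.[:0] = 1 -> f \is a GRing.unit.
Proof.
move=> f0; have h0 : (1 - f).[:0] = 0 by rewrite fcoefB f0 fcoef1 subrr.
pose s n := \sum_(k < n.+1) (1 - f) ^+ k.
have sf n : f * s n = 1 - (1 - f) ^+ n.+1 by rewrite -[RHS]opprB subrX1 -/(s n); ring.
pose h := Fps (fun n => (s n).[:n]).
have hs n : h = s n %[modX n.+1].
  move=> i; rewrite ltnS => le_in /=; rewrite /s !fcoef_sum.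
  rewrite -(subnKC le_in) -addSn big_split_ord /= [X in _ = _ + X]big1 ?addr0 // => k _.
  by rewrite fcoef0_eq0_exp //; lia.
apply/unitrP; exists h; suff hf : f * h = 1 by split=> //; rewrite mulrC.
apply: fpsP => n; rewrite (@eqmodXM n.+1 f f h (s n)) // sf fcoefB.
by rewrite fcoef0_eq0_exp ?subr0.
Qed.

Lemma fps_mulI (f : fps) : f.[:0] = 1 -> injective ( *%R f).
Proof. by move=> f0; apply: mulrI; apply: fps_unit_geom. Qed.

Lemma eqmodX_mulI n (f g h : fps) : f.[:0] = 1 ->
  f * g = f * h %[modX n] -> g = h %[modX n].
Proof.
move=> /fps_unit_geom fu fgh; rewrite -[g](mulKr fu) -[h](mulKr fu).
exact: eqmodXM.
Qed.

Lemma fps_mulrnI k (f g : fps) : (0 < k)%N -> f *+ k = g *+ k -> f = g.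
Proof.
move=> k0 fg; apply: fpsP => n; have : (f *+ k).[:n] = (g *+ k).[:n] by rewrite fg.
rewrite !fcoefMn => /eqP; rewrite -subr_eq0 -mulrnBl mulrn_eq0 subr_eq0.
by rewrite eqn0Ngt k0 => /eqP.
Qed.

(** * Coefficientwise limits *)

Definition fcvg (u : nat -> fps) (l : fps) :=
  forall n, exists N, forall m, (N <= m)%N -> u m = l %[modX n].

Lemma fcvg_unique u l l' : fcvg u l -> fcvg u l' -> l = l'.
Proof.
move=> ul ul'; apply: eqmodXP => n.
have [N uN] := ul n; have [N' uN'] := ul' n.
apply: (@eqmodX_trans _ (u (maxn N N'))).
  by apply/eqmodX_sym/uN/leq_maxl.
by apply/uN'/leq_maxr.
Qed.

Lemma fcvg_cst l : fcvg (fun=> l) l.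
Proof. by move=> n; exists 0%N. Qed.

Lemma fcvg_ext u v l : (forall n, u n = v n) -> fcvg u l -> fcvg v l.
Proof. by move=> /funext ->. Qed.

Lemma fcvg_sub u l (s : nat -> nat) : (forall n, (n <= s n)%N) ->
  fcvg u l -> fcvg (u \o s) l.
Proof.
move=> le_s ul n; have [N uN] := ul n; exists N => m le_Nm.
by apply: uN; apply: leq_trans le_Nm (le_s m).
Qed.

Lemma fcvgD u v l l' : fcvg u l -> fcvg v l' -> fcvg (fun n => u n + v n) (l + l').
Proof.
move=> ul vl n; have [N uN] := ul n; have [N' vN] := vl n.
exists (maxn N N') => m; rewrite geq_max => /andP[le1 le2].
by apply: eqmodXD; [apply: uN | apply: vN].
Qed.

Lemma fcvgM u v l l' : fcvg u l -> fcvg v l' -> fcvg (fun n => u n * v n) (l * l').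
Proof.
move=> ul vl n; have [N uN] := ul n; have [N' vN] := vl n.
exists (maxn N N') => m; rewrite geq_max => /andP[le1 le2].
by apply: eqmodXM; [apply: uN | apply: vN].
Qed.

Lemma fcvg_stable (u : nat -> fps) :
  (forall n, u n.+1 = u n %[modX n]) -> fcvg u (Fps (fun n => (u n.+1).[:n])).
Proof.
move=> uS; have uD n m : u (n + m)%N = u n %[modX n].
  elim: m => [|m IH]; rewrite ?addn0 // addnS.
  by apply: eqmodX_trans IH; apply: eqmodXW (uS _); apply: leq_addr.
move=> n; exists n => m le_nm i lt_in /=.
by rewrite -(subnKC (leq_trans lt_in le_nm)) uD.
Qed.

(** * Dilation and dissection *)

Lemma big_ord_dvd (k m : nat) (F : nat -> int) : (0 < k)%N ->
  (forall i, ~~ (k %| i)%N -> F i = 0) ->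
  \sum_(i < (k * m).+1) F i = \sum_(j < m.+1) F (k * j)%N.
Proof.
move=> k0 F0; elim: m => [|m IH]; first by rewrite muln0 !big_ord1 muln0.
rewrite [RHS]big_ord_recr -IH /= -!(big_mkord xpredT F).
rewrite (@big_cat_nat _ _ _ (k * m).+1) //=; last by lia.
congr (_ + _); rewrite mulnS big_nat_recr /=; last by lia.
rewrite big_nat_cond big1 ?add0r // => i /andP[/andP[lo hi] _].
apply: F0; apply/negP => /dvdnP[j def_i].
move: lo hi; rewrite def_i (mulnC j) -mulnS !ltn_pmul2l //; lia.
Qed.

(** This is f(q^k). Its companion [usec k r f], for [r < k], is the Atkin operator U_k applied to
    q^(-r) f. *)
Definition dil k f := Fps (fun n => if (k %| n)%N then f.[:n %/ k] else 0).
Definition usec k r f := Fps (fun n => f.[:k * n + r]).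

Lemma fcoef_dil k f n :
  (dil k f).[:n] = if (k %| n)%N then f.[:n %/ k] else 0.
Proof. by []. Qed.
Lemma fcoef_usec k r f n : (usec k r f).[:n] = f.[:k * n + r].
Proof. by []. Qed.

Lemma usec_dilM k r f g : (r < k)%N -> usec k r (dil k f * g) = f * usec k r g.
Proof.
move=> lt_rk; have k0 : (0 < k)%N by lia.
apply: fpsP => n; rewrite [LHS]/= !fcoefM.
pose F i := (dil k f).[:i] * g.[:k * n + r - i].
(* The last [r] indices lie strictly between [k * n] and [k * n.+1], where [dil k f] has no
   coefficient. *)
rewrite -addSn big_split_ord /= [X in _ + X]big1 ?addr0; last first.
  move=> [i lt_ir] _ /=; case: ifP => [|_]; last by rewrite mul0r.
  by rewrite addSnnS dvdn_addr ?dvdn_mulr // gtnNdvd //; lia.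
rewrite (eq_bigr (fun i : 'I__ => F i)) // big_ord_dvd //; last first.
  by rewrite /F /= => i /negPf ->; rewrite mul0r.
apply: eq_bigr => -[j lt_jn] _; rewrite /F /= dvdn_mulr // mulKn //.
by congr (_ * _.[:_]); nia.
Qed.

Lemma usecP k f g : (0 < k)%N ->
  (forall r, (r < k)%N -> usec k r f = usec k r g) -> f = g.
Proof.
move=> k0 fg; apply: fpsP => n; rewrite (divn_eq n k) mulnC.
exact: (congr1 (fun h => h.[:n %/ k]) (fg _ (ltn_pmod n k0))).
Qed.

Lemma usecD k r f g : usec k r (f + g) = usec k r f + usec k r g.
Proof. exact: fpsP. Qed.
Lemma usec0 k r : usec k r 0 = 0.
Proof. by apply: fpsP => n; rewrite fcoef_usec !fcoef0. Qed.

HB.instance Definition _ k r := GRing.isNmodMorphism.Build fps fps (usec k r)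
  (usec0 k r, usecD k r).

Lemma usec_dil k f : (0 < k)%N -> usec k 0 (dil k f) = f.
Proof. by move=> k0; apply: fpsP => n /=; rewrite addn0 dvdn_mulr ?mulKn. Qed.

Lemma usec_dil_gt0 k r f : (0 < r < k)%N -> usec k r (dil k f) = 0.
Proof.
move=> /andP[r0 rk]; apply: fpsP => n; rewrite fcoef_usec fcoef_dil fcoef0.
by rewrite dvdn_addr ?dvdn_mulr // gtnNdvd.
Qed.

Lemma dilD k f g : dil k (f + g) = dil k f + dil k g.
Proof. by apply: fpsP => n; rewrite !(fcoef_dil, fcoefD); case: ifP. Qed.
Lemma dil_zero k : dil k 0 = 0.
Proof. by apply: fpsP => n; rewrite fcoef_dil !fcoef0; case: ifP. Qed.
Lemma dil_one k : dil k 1 = 1.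
Proof.
apply: fpsP => n; rewrite fcoef_dil !fcoef1.
have [->|n0] := posnP n; first by rewrite dvdn0 div0n.
case: ifP => // kn.
have k0 : (0 < k)%N by case: k kn => //; rewrite dvd0n; lia.
suff : (0 < n %/ k)%N by case: (n %/ k)%N.
by rewrite divn_gt0 // dvdn_leq.
Qed.
Lemma dilM k f g : dil k (f * g) = dil k f * dil k g.
Proof.
(* [dil 0] keeps only the constant term, hence a separate case; for positive [k] the residue classes
   are compared one by one. *)
case: (posnP k) => [->|k0].
  apply: fpsP => -[|n]; first by rewrite fcoefM0 !fcoef_dil dvdn0 div0n fcoefM0.
  rewrite [LHS]fcoef_dil dvd0n [RHS]fcoefM big1 // => -[[|i] lt_i] _.
    by rewrite [(dil 0 g).[:_]]fcoef_dil subn0 mulr0.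
  by rewrite [(dil 0 f).[:_]]fcoef_dil mul0r.
apply: (usecP k0) => r lt_rk; rewrite usec_dilM //.
case: r lt_rk => [|r] lt_rk; first by rewrite !usec_dil.
by rewrite !usec_dil_gt0 // mulr0.
Qed.

HB.instance Definition _ k := GRing.isNmodMorphism.Build fps fps (dil k)
  (dil_zero k, dilD k).
HB.instance Definition _ k := GRing.isMonoidMorphism.Build fps fps (dil k)
  (dil_one k, dilM k).

Lemma dil_q k : (0 < k)%N -> dil k 'q = 'q ^+ k.
Proof.
move=> k0; apply: fpsP => n; rewrite fcoef_qX fcoef_dil; case: eqP => [->|nk].
  by rewrite dvdnn divnn k0.
case: ifP => // /dvdnP[j def_n]; rewrite def_n mulnK //.
rewrite -['q]expr1 fcoef_qX.
by case: eqP => // j1; case: nk; rewrite def_n j1 mul1n.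
Qed.

Lemma dil1 f : dil 1 f = f.
Proof. by apply: fpsP => n /=; rewrite dvd1n divn1. Qed.

Lemma dil_dil a b f : (0 < a)%N -> dil a (dil b f) = dil (a * b) f.
Proof.
move=> a0; apply: fpsP => n /=; case: ifP => [/dvdnP[j ->]|ndvd].
  by rewrite mulnK // [(a * b)%N]mulnC dvdn_pmul2r // divnMr.
by case: ifP => // /(dvdn_trans (dvdn_mulr _ (dvdnn a))); rewrite ndvd.
Qed.

Lemma fcoef0_dil k f : (dil k f).[:0] = f.[:0].
Proof. by rewrite /= dvdn0 div0n. Qed.

Lemma eqmodX_dil k n f g : (0 < k)%N ->
  f = g %[modX n] -> dil k f = dil k g %[modX n].
Proof.
move=> k0 fg i lt_in /=; case: ifP => // _; apply: fg.
exact: leq_ltn_trans (leq_div _ _) lt_in.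
Qed.

Lemma fcvg_dil k u l : (0 < k)%N -> fcvg u l -> fcvg (fun n => dil k (u n)) (dil k l).
Proof.
move=> k0 ul n; have [N uN] := ul n; exists N => m le_Nm.
by apply: eqmodX_dil => //; apply: uN.
Qed.

(** * 3-dissections and the cubic norm *)

Definition dis3 (a b c : fps) := dil 3 a + 'q * dil 3 b + 'q ^+ 2 * dil 3 c.

Lemma usec_dis3 a b c : ((usec 3 0 (dis3 a b c) = a) *
  (usec 3 1 (dis3 a b c) = b) * (usec 3 2 (dis3 a b c) = c))%type.
Proof.
have q r : usec 3 r 'q = (r == 1%N)%:R.
  by apply: fpsP => -[|[|n]]; case: r => [|[|r]]; rewrite fcoef_usec ?fcoef0 ?fcoef1 //=; lia.
have q2 r : usec 3 r ('q ^+ 2) = (r == 2%N)%:R.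
  by apply: fpsP => n; rewrite fcoef_usec fcoef_qX; case: n => [|n];
     case: r => [|[|[|r]]]; rewrite ?fcoef0 ?fcoef1 //=; case: eqP => //; lia.
have one r : (0 < r < 3)%N -> usec 3 r 1 = 0.
  by move=> ?; rewrite -(dil_one 3) usec_dil_gt0.
have one0 : usec 3 0 1 = 1 by rewrite -[X in usec _ _ X](dil_one 3) usec_dil.
by rewrite /dis3 -[dil 3 a]mulr1 ![_ * dil 3 _]mulrC !usecD !usec_dilM //
  !q !q2 one0 !one //= !mulr0 !mulr1 !addr0 !add0r.
Qed.

Lemma dis3_usec f : f = dis3 (usec 3 0 f) (usec 3 1 f) (usec 3 2 f).
Proof. by apply: (@usecP 3) => // -[|[|[|r]]] //; rewrite usec_dis3. Qed.

Lemma dis3M a b c a' b' c' : dis3 a b c * dis3 a' b' c' =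
  dis3 (a * a' + 'q * (b * c' + c * b'))
       (a * b' + b * a' + 'q * (c * c'))
       (a * c' + b * b' + c * a').
Proof. by rewrite /dis3 !(rmorphD, rmorphM) /= dil_q //; ring. Qed.

(* The product of [f (w q)] over the cube roots of unity [w], as a series in [q ^ 3]. *)
Definition norm3 f :=
  let a := usec 3 0 f in let b := usec 3 1 f in let c := usec 3 2 f in
  a ^+ 3 + 'q * b ^+ 3 + 'q ^+ 2 * c ^+ 3 - 3 * 'q * a * b * c.

Lemma norm3_dis3 a b c : norm3 (dis3 a b c) =
  a ^+ 3 + 'q * b ^+ 3 + 'q ^+ 2 * c ^+ 3 - 3 * 'q * a * b * c.
Proof. by rewrite /norm3 !usec_dis3. Qed.

(** With t^3 = q, the form is the norm of a + b t + c t^2 down to Z[[q]], hence multiplicative; on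
    sections this is a polynomial identity. *)
Lemma norm3M f g : norm3 (f * g) = norm3 f * norm3 g.
Proof.
rewrite [f]dis3_usec [g]dis3_usec dis3M !norm3_dis3.
by ring.
Qed.

Lemma norm3_one : norm3 1 = 1.
Proof.
have E : 1 = dis3 1 0 0 by rewrite /dis3 dil_one dil_zero; ring.
by rewrite {1}E norm3_dis3; ring.
Qed.

Lemma norm3_dil3 f : norm3 (dil 3 f) = f ^+ 3.
Proof.
have -> : dil 3 f = dis3 f 0 0 by rewrite /dis3 dil_zero; ring.
by rewrite norm3_dis3; ring.
Qed.

(** Squaring permutes the cube roots of unity. On sections it swaps classes 1 and 2, and class 2
    lands on exponent 4 = 3 + 1, whence the extra ['q]. *)
Lemma norm3_dil2 f : norm3 (dil 2 f) = dil 2 (norm3 f).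
Proof.
rewrite [f]dis3_usec.
set a := usec 3 0 f; set b := usec 3 1 f; set c := usec 3 2 f.
have -> : dil 2 (dis3 a b c) = dis3 (dil 2 a) ('q * dil 2 c) (dil 2 b).
  rewrite /dis3 !(rmorphD, rmorphM, rmorphXn) /= !dil_q // !dil_dil //.
  by rewrite (mulnC 2 3); ring.
rewrite !norm3_dis3 !(rmorphD, rmorphN, rmorphM, rmorphXn, rmorph_nat) /= !dil_q //.
by ring.
Qed.

(** The product of 1 - w^k q^k over the cube roots w is (1 - q^k)^3 or 1 - q^(3k), according to
    whether 3 divides k; q^3 is then renamed q. *)
Lemma norm3_1BqX k : norm3 (1 - 'q ^+ k) =
  if (3 %| k)%N then (1 - 'q ^+ (k %/ 3)) ^+ 3 else 1 - 'q ^+ k.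
Proof.
have k3 m : 'q ^+ (3 * m) = dil 3 ('q ^+ m) by rewrite rmorphXn /= dil_q // -exprM.
have := divn_eq k 3; set m := (k %/ 3)%N => def_k.
have [r0|r0] := altP (@eqP _ (k %% 3)%N 0%N).
  rewrite /dvdn r0 eqxx def_k r0 addn0 mulnC k3.
  have -> : 1 - dil 3 ('q ^+ m) = dil 3 (1 - 'q ^+ m) by rewrite rmorphB /= dil_one.
  exact: norm3_dil3.
rewrite /dvdn (negPf r0).
have : (k = 3 * m + 1)%N \/ (k = 3 * m + 2)%N by lia.
case=> ->; rewrite exprD k3.
  have E : 1 - dil 3 ('q ^+ m) * 'q ^+ 1 = dis3 1 (- 'q ^+ m) 0.
    by rewrite /dis3 rmorphN dil_one dil_zero /=; ring.
  by rewrite {1}E norm3_dis3 rmorphXn /= dil_q // (exprAC 'q 3 m); ring.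
have E : 1 - dil 3 ('q ^+ m) * 'q ^+ 2 = dis3 1 0 (- 'q ^+ m).
  by rewrite /dis3 rmorphN dil_one dil_zero /=; ring.
by rewrite {1}E norm3_dis3 rmorphXn /= dil_q // (exprAC 'q 3 m); ring.
Qed.

(** Coefficients of the norm below [n] depend only on coefficients of the series below [3 * n]. *)
Lemma fcvg_norm3 u l : fcvg u l -> fcvg (fun n => norm3 (u n)) (norm3 l).
Proof.
move=> ul n; have [N uN] := ul (3 * n)%N; exists N => m le_Nm.
have E r : (r < 3)%N -> usec 3 r (u m) = usec 3 r l %[modX n].
  by move=> r3 i lt_in /=; apply: uN => //; lia.
have [E0 E1 E2] := And3 (E 0%N isT) (E 1%N isT) (E 2%N isT).
rewrite /norm3; do ?[apply: eqmodXD | apply: eqmodXN | apply: eqmodXM |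
  apply: eqmodX_exp | done].
Qed.

(** * The Jacobi triple product *)

Section FiniteTripleProduct.
Variables (R : comNzRingType) (x y : R).
Local Notation Q := (x * y).

(** Gaussian binomials in base [Q], given by a Pascal rule because the ring has no division. *)
Fixpoint gbin n k : R :=
  match n, k with
  | _, 0 => 1
  | 0, _.+1 => 0
  | n'.+1, k'.+1 => gbin n' k' + Q ^+ k * gbin n' k
  end.

Definition qfact n : R := \prod_(i < n) (1 - Q ^+ i.+1).

Lemma gbin0 n : gbin n 0 = 1. Proof. by case: n. Qed.

Lemma gbinS n k : gbin n.+1 k.+1 = gbin n k + Q ^+ k.+1 * gbin n k.+1.
Proof. by []. Qed.

Lemma gbin_small n k : (n < k)%N -> gbin n k = 0.
Proof.
elim: n k => [|n IH] [|k] //; rewrite ltnS => lt_nk.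
by rewrite gbinS !IH ?mulr0 ?addr0 //; apply: leqW.
Qed.

Lemma gbinn n : gbin n n = 1.
Proof. by elim: n => // n IH; rewrite gbinS IH gbin_small // mulr0 addr0. Qed.

(** The second q-Pascal rule: it serves the induction on [M] in the finite triple product, the
    defining rule the induction on [N]. *)
Lemma gbinS_rev n k : (k <= n)%N ->
  gbin n.+1 k.+1 = Q ^+ (n - k) * gbin n k + gbin n k.+1.
Proof.
elim: n k => [|n IH] [|k] //; rewrite ?ltnS => le_kn.
- by rewrite gbinS gbin0 gbin_small //= mulr0 mul1r.
- rewrite gbinS {1}(IH 0%N) // [gbin n.+1 1]gbinS !gbin0 !subn0 (exprS _ n); ring.
rewrite [LHS]gbinS [in LHS](IH k) // subSS [in RHS](gbinS n k) [in RHS](gbinS n k.+1).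
have [lt_kn|ge_kn] := ltnP k n; last first.
  by rewrite (@gbin_small n.+1 k.+2) ?(@gbin_small n k.+1) ?(@gbin_small n k.+2);
    try ring; lia.
rewrite (IH k.+1) //.
have -> : Q ^+ (n - k) = Q ^+ (n - k.+1) * Q by rewrite -exprSr subnSK.
by rewrite !exprS; ring.
Qed.

Lemma gbin_qfact j m : gbin (j + m) j * (qfact j * qfact m) = qfact (j + m).
Proof.
have [n] := ubnP (j + m); elim: n j m => // n IH [|j] [|m] lt_n.
- by rewrite gbin0 /qfact !big_ord0; ring.
- by rewrite gbin0 add0n {1}/qfact big_ord0; ring.
- by rewrite addn0 gbinn {2}/qfact big_ord0; ring.
have qS k : qfact k.+1 = qfact k * (1 - Q ^+ k.+1) by rewrite /qfact big_ord_recr.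
rewrite addSn gbinS mulrDl.
have -> : gbin (j + m.+1) j * (qfact j.+1 * qfact m.+1) =
          (1 - Q ^+ j.+1) * qfact (j + m.+1).
  by rewrite -IH; [rewrite (qS j); ring | lia].
have -> : Q ^+ j.+1 * gbin (j + m.+1) j.+1 * (qfact j.+1 * qfact m.+1) =
          Q ^+ j.+1 * (1 - Q ^+ m.+1) * qfact (j + m.+1).
  by rewrite -addSnnS -IH; [rewrite (qS m); ring | lia].
by rewrite qS -addSn exprD; ring.
Qed.

(* [theta_term a b] is Ramanujan's [x ^ (n (n + 1) / 2) * y ^ (n (n - 1) / 2)]
   at the integer [n = a - b]; one of the two truncated differences is 0. *)
Definition theta_term a b : R :=
  x ^+ ('C((a - b).+1, 2) + 'C(b - a, 2)) * y ^+ ('C(a - b, 2) + 'C((b - a).+1, 2)).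

Lemma theta_termSS a b : theta_term a.+1 b.+1 = theta_term a b.
Proof. by rewrite /theta_term !subSS. Qed.

(** This lemma and the next three all say that the term at n + 1 is x Q^n times the term at n, split
    by the sign of n so that only nonnegative powers of [Q] occur. *)
Lemma theta_term_ge d b : theta_term (d + b).+1 b = x * Q ^+ d * theta_term (d + b) b.
Proof.
rewrite /theta_term -addSn !addnK.
have z e : (b - (e + b) = 0)%N by lia.
rewrite !z !(binS _ 1) !bin1 !addn0 !exprD exprMn !exprS; ring.
Qed.

Lemma theta_term_lt d a :
  x * theta_term a (d.+1 + a) = Q ^+ d.+1 * theta_term a.+1 (d.+1 + a).
Proof.
rewrite /theta_term addSn !subSS -addSn !addnK.
have z e : (a - (e + a) = 0)%N by lia.
rewrite !z !(binS _ 1) !bin1 !add0n !exprD exprMn !exprS; ring.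
Qed.

Lemma theta_term_le d a : theta_term a (d + a).+1 = y * Q ^+ d * theta_term a (d + a).
Proof.
rewrite /theta_term -addSn !addnK.
have z e : (a - (e + a) = 0)%N by lia.
rewrite !z !(binS _ 1) !bin1 !add0n !exprD exprMn !exprS; ring.
Qed.

Lemma theta_term_gt d b :
  y * theta_term (d.+1 + b) b = Q ^+ d.+1 * theta_term (d.+1 + b) b.+1.
Proof.
rewrite /theta_term addSn !subSS -addSn !addnK.
have z e : (b - (e + b) = 0)%N by lia.
rewrite !z !(binS _ 1) !bin1 !addn0 !exprD exprMn !exprS; ring.
Qed.

(** The resulting power of [Q] is the one in [gbinS_rev], so multiplying by [1 + x * Q ^+ M] passes
    to the next row of Gaussian binomials. *)
Lemma theta_term_stepx M N j : (j <= M + N)%N ->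
  x * Q ^+ M * theta_term j N = Q ^+ (M + N - j) * theta_term j.+1 N.
Proof.
have [le_Nj|lt_jN] := leqP N j => le_j.
  rewrite -(subnK le_Nj) theta_term_ge; set d := (j - N)%N.
  have -> : M = (M + N - (d + N) + d)%N by lia.
  by rewrite exprD (_ : (_ - _)%N = (M + N - (d + N))%N); [ring | lia].
have -> : N = ((N - j.+1).+1 + j)%N by lia.
set d := (N - j.+1)%N; rewrite mulrAC theta_term_lt mulrAC -exprD; congr (Q ^+ _ * _); lia.
Qed.

Lemma theta_term_stepy N j :
  y * Q ^+ N * theta_term j N = Q ^+ j * theta_term j N.+1.
Proof.
have [lt_Nj|le_jN] := ltnP N j.
  have -> : j = ((j - N.+1).+1 + N)%N by lia.
  by rewrite mulrAC theta_term_gt mulrAC -exprD.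
by rewrite -(subnK le_jN) theta_term_le exprD; ring.
Qed.

Lemma finite_triple_product M N :
  \sum_(j < (M + N).+1) gbin (M + N) j * theta_term j N =
  (\prod_(k < M) (1 + x * Q ^+ k)) * \prod_(k < N) (1 + y * Q ^+ k).
Proof.
pose S n N' := \sum_(j < n.+1) gbin n j * theta_term j N'.
rewrite -/(S (M + N)%N N); elim: M => [|M IH]; last first.
  have recr n N' : S n N' = theta_term 0 N' +
      \sum_(j < n.+1) gbin n j.+1 * theta_term j.+1 N'.
    rewrite [in RHS]big_ord_recr /= gbin_small // mul0r addr0.
    by rewrite /S big_ord_recl gbin0 mul1r.
  have -> : S (M.+1 + N)%N N = (1 + x * Q ^+ M) * S (M + N)%N N.
    rewrite mulrDl mul1r [X in _ = X + _]recr [LHS]/S addSn big_ord_recl gbin0 mul1r -addrA.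
    congr (_ + _); rewrite mulr_sumr -big_split; apply: eq_bigr => -[j lt_j] _.
    rewrite lift0 [j in gbin _ j.+1]/= gbinS_rev // mulrDl addrC; congr (_ + _).
    by rewrite /= mulrAC -theta_term_stepx //; ring.
  by rewrite IH big_ord_recr /=; ring.
(* For [M = 0], each new factor in [y] also moves the centre of the sum from [N] to [N.+1];
   [theta_termSS] realigns the terms. *)
rewrite big_ord0 mul1r add0n; elim: N => [|N IH].
  by rewrite /S big_ord1 big_ord0 /theta_term !subnn !bin_small // !expr0 !mulr1.
have -> : S N.+1 N.+1 = (1 + y * Q ^+ N) * S N N.
  rewrite mulrDl mul1r [LHS]/S big_ord_recl gbin0 mul1r.
  rewrite (eq_bigr (fun j : 'I_N.+1 => gbin N j * theta_term j N +
    Q ^+ j.+1 * gbin N j.+1 * theta_term j.+1 N.+1)); last first.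
    by move=> j _; rewrite lift0 gbinS mulrDl theta_termSS.
  rewrite big_split /= addrCA; congr (_ + _).
  rewrite mulr_sumr [RHS](eq_bigr (fun j : 'I_N.+1 => Q ^+ j * gbin N j * theta_term j N.+1)).
    rewrite [RHS]big_ord_recl gbin0 expr0 !mul1r; congr (_ + _).
    rewrite big_ord_recr /= gbin_small // mulr0 mul0r addr0.
    by apply: eq_bigr.
  by move=> j _; rewrite mulrCA theta_term_stepy mulrCA mulrA.
by rewrite IH big_ord_recr /=; ring.
Qed.

End FiniteTripleProduct.

Definition theta_sum (x y : fps) N := \sum_(j < (N + N).+1) theta_term x y j N.

(** The exponent of [y] is at least |a - b| - 1. Smallness is drawn from [y] alone because [psi] is
    obtained with [x = 1]. *)
Lemma theta_term_mod x y a b n : y.[:0] = 0 -> (n < (a - b) + (b - a))%N ->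
  theta_term x y a b = 0 %[modX n].
Proof.
move=> y0 lt_n i lt_in; rewrite /theta_term mulrC fcoef0.
suff E : y ^+ ('C(a - b, 2) + 'C((b - a).+1, 2)) = 0 %[modX n].
  by rewrite (@eqmodXM n _ 0 _ (x ^+ ('C((a - b).+1, 2) + 'C(b - a, 2))) E) // mul0r fcoef0.
move=> k lt_kn; rewrite fcoef0 fcoef0_eq0_exp //; apply: leq_trans lt_kn _.
have bin_ge m : (m <= 'C(m, 2).+1)%N by case: m => // m; rewrite binS bin1; lia.
have := bin_ge (a - b)%N; have := bin_ge (b - a)%N; rewrite binS bin1.
by case: (leqP a b) => [le_ab|lt_ba]; lia.
Qed.

(** Both parameters of the finite identity are set to [N]; multiplying by [Z] clears the limit 1/Z
    of the central Gaussian binomials. *)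
Theorem triple_product (x y X Y Z : fps) : y.[:0] = 0 ->
  fcvg (fun N => \prod_(k < N) (1 + x * (x * y) ^+ k)) X ->
  fcvg (fun N => \prod_(k < N) (1 + y * (x * y) ^+ k)) Y ->
  fcvg (qfact x y) Z -> fcvg (theta_sum x y) (X * Y * Z).
Proof.
move=> y0 cX cY cZ n.
have Q0 : (x * y).[:0] = 0 by rewrite fcoefM0 y0 mulr0.
have Z0 : Z.[:0] = 1.
  have [N cN] := cZ 1%N; rewrite -(cN N) //.
  rewrite /qfact; apply: (big_ind (fun f : fps => f.[:0] = 1)) => // [f g f1 g1|i _].
    by rewrite fcoefM0 f1 g1.
  by rewrite fcoefB fcoefX0 Q0 exprS mul0r subr0.
have [Nx cNx] := cX n; have [Ny cNy] := cY n; have [Nz cNz] := cZ n.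
exists (Nx + Ny + Nz + n)%N => N le_N; apply: eqmodX_sym.
have E := finite_triple_product x y N N.
apply: (@eqmodX_trans _ ((\sum_(j < (N + N).+1) gbin x y (N + N) j * theta_term x y j N) * Z)).
  rewrite E; do 2?apply: eqmodXM => //; apply: eqmodX_sym.
    by apply: cNx; lia.
  by apply: cNy; lia.
rewrite mulr_suml; apply: eqmodX_sum => -[j lt_j] _ _.
(* Terms with |j - N| > n vanish modulo q^n; for the others both [j] and [N + N - j] are at least
   [Nz]. *)
rewrite [nat_of_ord _]/=; have [far|near] := ltnP n ((j - N) + (N - j)).
  have t0 := theta_term_mod x y0 far.
  apply: (@eqmodX_trans _ 0); last exact: eqmodX_sym.
  rewrite -[X in eqmodX _ _ X](mul0r Z) -[X in eqmodX _ _ (X * _)](mulr0 (gbin x y (N + N) j)).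
  by do 2?apply: eqmodXM.
rewrite mulrAC -[X in eqmodX _ _ X]mul1r; apply: eqmodXM => //.
(* The three [qfact] values in [gbin_qfact] all agree with [Z] modulo q^n, so [gbin] times Z^2 is Z,
   and one [Z] cancels. *)
apply: (@eqmodX_mulI _ Z) => //; rewrite mulr1.
have def2N : (N + N = j + (N + N - j))%N by lia.
apply: (@eqmodX_trans _ (qfact x y (N + N))); last by apply: cNz; lia.
rewrite [in X in eqmodX _ _ X]def2N -gbin_qfact -def2N mulrCA.
by do 2?apply: eqmodXM => //; apply/eqmodX_sym/cNz; lia.
Qed.

(** * Infinite products *)

(** Coefficient [n] is already final after [n.+1] factors when each factor [k] is 1 modulo q^k. *)
Definition iprod (f : nat -> fps) := Fps (fun n => (\prod_(k < n.+1) f k).[:n]).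

Lemma fcvg_iprod f : (forall k, f k = 1 %[modX k]) ->
  fcvg (fun N => \prod_(k < N) f k) (iprod f).
Proof.
move=> f1; apply: (@fcvg_stable (fun N => \prod_(k < N) f k)) => n.
rewrite big_ord_recr -[X in eqmodX _ _ X]mulr1; exact: eqmodXM.
Qed.

Lemma fcoef0_iprod f : (f 0%N).[:0] = 1 -> (iprod f).[:0] = 1.
Proof. by rewrite /iprod => f0; rewrite /= big_ord1. Qed.

(** * Dissections of theta series *)

Definition theta_exp a b j N :=
  (a * ('C((j - N).+1, 2) + 'C(N - j, 2)) + b * ('C(j - N, 2) + 'C((N - j).+1, 2)))%N.

(** Doubling and using the signed index [n] removes binomials and truncated subtractions, so
    exponent comparisons become polynomial identities. *)
Lemma theta_expE a b j N (n := j%:Z - N%:Z) :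
  (theta_exp a b j N)%:Z *+ 2 = (a%:Z + b%:Z) * n ^+ 2 + (a%:Z - b%:Z) * n.
Proof.
have bin2Z d : ('C(d, 2))%:Z *+ 2 = d%:Z * d%:Z - d%:Z.
  elim: d => [|d IH]; first by rewrite bin0n.
  by rewrite binS bin1 PoszD mulrnDl IH intS; ring.
rewrite /theta_exp.
move: (bin2Z (j - N).+1) (bin2Z (N - j)%N) (bin2Z (j - N)%N) (bin2Z (N - j).+1).
move: ('C((j - N).+1, 2)) ('C(N - j, 2)) ('C(j - N, 2)) ('C((N - j).+1, 2)).
move=> z w v u hz hw hv hu.
have -> : (a * (z + w) + b * (v + u))%N%:Z *+ 2 =
  a%:Z * (z%:Z *+ 2 + w%:Z *+ 2) + b%:Z * (v%:Z *+ 2 + u%:Z *+ 2).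
  by rewrite !PoszD !PoszM !PoszD; ring.
rewrite hu hv hw hz /n; case: (leqP j N) => [le_jN|/ltnW le_Nj].
  have -> : (j - N = 0)%N by lia.
  by rewrite -[in RHS](subnK le_jN) PoszD !intS; ring.
have -> : (N - j = 0)%N by lia.
by rewrite -[in RHS](subnK le_Nj) PoszD !intS; ring.
Qed.

Lemma theta_exp_eq a b j N k a' b' j' N' e :
  (theta_exp a b j N)%:Z *+ 2 = k%:Z * ((theta_exp a' b' j' N')%:Z *+ 2) + e%:Z *+ 2 ->
  theta_exp a b j N = (k * theta_exp a' b' j' N' + e)%N.
Proof. by move=> E; apply/eqP; rewrite -eqz_nat PoszD PoszM; lia. Qed.

(** The exponents of the two arguments add up to (j - N)^2, which has the parity of [j + N]; this
    fixes the sign. *)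
Lemma theta_termE s a b j N :
  theta_term ((-1) ^+ s * 'q ^+ a) ((-1) ^+ s * 'q ^+ b) j N =
  (-1) ^+ (s * (j + N)) * 'q ^+ theta_exp a b j N.
Proof.
rewrite /theta_term !exprMn mulrACA -!exprM -exprD; congr (_ * _).
  rewrite -[LHS]signr_odd -[RHS]signr_odd -mulnDr !oddM; congr (_ ^+ (_ && _)).
  have bin2 d : ('C(d.+1, 2) + 'C(d, 2) = d * d)%N.
    by elim: d => // d; rewrite !(binS _ 1) !bin1; lia.
  have -> : ('C((j - N).+1, 2) + 'C(N - j, 2) + ('C(j - N, 2) + 'C((N - j).+1, 2)) =
     (j - N) * (j - N) + (N - j) * (N - j))%N by rewrite -!bin2; lia.
  by rewrite oddD !oddM !andbb -oddD; case: (leqP j N) => ?; lia.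
by rewrite -exprD.
Qed.

(** A term of one theta series is matched with a term of another at q^k; [t] is the shift in sign
    parity and [e] the leftover power of q. *)
Lemma theta_term_dissect s a b j N k a' b' j' N' t e (x y x' y' : fps) : (0 < k)%N ->
  x = (-1) ^+ s * 'q ^+ a -> y = (-1) ^+ s * 'q ^+ b ->
  x' = (-1) ^+ s * 'q ^+ a' -> y' = (-1) ^+ s * 'q ^+ b' ->
  odd (j + N) = odd (t + (j' + N')) ->
  (theta_exp a b j N)%:Z *+ 2 = k%:Z * ((theta_exp a' b' j' N')%:Z *+ 2) + e%:Z *+ 2 ->
  theta_term x y j N =
  (-1) ^+ (s * t) * 'q ^+ e * dil k (theta_term x' y' j' N').
Proof.
move=> k0 -> -> -> -> odd_t /theta_exp_eq exp_e; rewrite !theta_termE.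
rewrite rmorphM rmorph_sign rmorphXn /= dil_q // exp_e.
have -> : (-1) ^+ (s * (j + N)) = (-1) ^+ (s * t) * (-1) ^+ (s * (j' + N')) :> fps.
  by rewrite -exprD -mulnDr -[LHS]signr_odd -[RHS]signr_odd !oddM odd_t.
by rewrite exprD (exprM 'q); ring.
Qed.

Lemma theta_sumC x y N : theta_sum x y N = theta_sum y x N.
Proof.
rewrite /theta_sum (reindex_inj rev_ord_inj); apply: eq_bigr => -[j lt_j] _ /=.
rewrite subSS /theta_term mulrC.
have [-> ->] : (N + N - j - N = N - j)%N /\ (N - (N + N - j) = j - N)%N by lia.
by congr (_ ^+ _ * _ ^+ _); rewrite addnC.
Qed.

Lemma big_ord3 (R : nmodType) M (F : nat -> R) :
  \sum_(j < 3 * M) F j = \sum_(i < M) (F (3 * i)%N + F (3 * i + 1)%N + F (3 * i + 2)%N).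
Proof.
elim: M => [|M IH]; first by rewrite muln0 !big_ord0.
by rewrite mulnS addnC addn3 !big_ord_recr /= IH addn1 addn2 !addrA.
Qed.

(** Truncation at [3 * N + 1] gives 3 (2 N + 1) terms, so the three residue classes have equal
    length. *)
Lemma theta_sum3 x y N : theta_sum x y (3 * N + 1) =
  \sum_(i < (N + N).+1) theta_term x y (3 * i) (3 * N + 1) +
  \sum_(i < (N + N).+1) theta_term x y (3 * i + 1) (3 * N + 1) +
  \sum_(i < (N + N).+1) theta_term x y (3 * i + 2) (3 * N + 1).
Proof.
rewrite /theta_sum (_ : (_ + _).+1 = 3 * (N + N).+1)%N; last by lia.
by rewrite (big_ord3 _ (fun j => theta_term x y j (3 * N + 1))) -!big_split.
Qed.

(** With m = i - N the classes carry the indices 3m - 1, 3m, 3m + 1. Here (3m)^2 = 9 m^2 and (3m -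
    1)^2 = 3 (3m^2 - 2m) + 1; the third class mirrors the first under m -> -m, whence the factor
    2. *)
Lemma theta_sum_phi3 N (x := - 'q) : theta_sum x x (3 * N + 1) =
  dil 9 (theta_sum x x N) - 2 * 'q * dil 3 (theta_sum x (- 'q ^+ 5) N).
Proof.
have E k : - 'q ^+ k = (-1) ^+ 1 * 'q ^+ k by rewrite mulN1r.
have E1 : x = (-1) ^+ 1 * 'q ^+ 1 by rewrite mulN1r.
have -> : 2 * 'q * dil 3 (theta_sum x (- 'q ^+ 5) N) =
  'q * dil 3 (theta_sum x (- 'q ^+ 5) N) + 'q * dil 3 (theta_sum (- 'q ^+ 5) x N).
  by rewrite [theta_sum (- 'q ^+ 5) _ _]theta_sumC; ring.
rewrite theta_sum3 /theta_sum !rmorph_sum /= !mulr_sumr opprD -!sumrN addrA.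
rewrite [X in _ = X + _]addrC.
congr (_ + _ + _); apply: eq_bigr => i _.
- rewrite (theta_term_dissect (t := 1) (e := 1) (ltn0Sn 2) E1 E1 E1 (E 5%N)
    (j' := i) (N' := N)); [by ring | lia | rewrite !theta_expE; lia].
- rewrite (theta_term_dissect (t := 0) (e := 0) (ltn0Sn 8) E1 E1 E1 E1
    (j' := i) (N' := N)); [by ring | lia | rewrite !theta_expE; lia].
- rewrite (theta_term_dissect (t := 1) (e := 1) (ltn0Sn 2) E1 E1 (E 5%N) E1
    (j' := i) (N' := N)); [by ring | lia | rewrite !theta_expE; lia].
Qed.

(** The exponent n (n - 1)/2 equals 9 m (m - 1)/2 + 1 at n = 3m - 1 and 3 (3m^2 - m)/2 at n = 3m;
    the class 3m + 1 mirrors the class 3m. *)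
Lemma theta_sum_psi3 N : theta_sum 1 'q (3 * N + 1) =
  2 * dil 3 (theta_sum 'q ('q ^+ 2) N) + 'q * dil 9 (theta_sum 1 'q N).
Proof.
have E k : 'q ^+ k = (-1) ^+ 0 * 'q ^+ k by rewrite mul1r.
have E0 : 1 = (-1) ^+ 0 * 'q ^+ 0 by rewrite mul1r.
have E1 : 'q = (-1) ^+ 0 * 'q ^+ 1 by rewrite mul1r.
have -> : 2 * dil 3 (theta_sum 'q ('q ^+ 2) N) =
  dil 3 (theta_sum 'q ('q ^+ 2) N) + dil 3 (theta_sum ('q ^+ 2) 'q N).
  by rewrite [theta_sum ('q ^+ 2) _ _]theta_sumC; ring.
rewrite theta_sum3 /theta_sum !rmorph_sum /= !mulr_sumr [RHS]addrC [RHS]addrA.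
congr (_ + _ + _); apply: eq_bigr => i _.
- rewrite (theta_term_dissect (t := 1) (e := 1) (ltn0Sn 8) E0 E1 E0 E1
    (j' := i) (N' := N)); [by ring | lia | rewrite !theta_expE; lia].
- rewrite (theta_term_dissect (t := 0) (e := 0) (ltn0Sn 2) E0 E1 E1 (E 2%N)
    (j' := i) (N' := N)); [by ring | lia | rewrite !theta_expE; lia].
- rewrite (theta_term_dissect (t := 1) (e := 0) (ltn0Sn 2) E0 E1 (E 2%N) E1
    (j' := i) (N' := N)); [by ring | lia | rewrite !theta_expE; lia].
Qed.

(** * Product formulas *)

(** The q-Pochhammer symbol (q^a; q^c) for [s = 1] and (-q^a; q^c) for [s = 0], with infinitely many
    factors. *)
Definition qprod s a c := iprod (fun k => 1 + (-1) ^+ s * 'q ^+ (a + c * k)).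

Lemma fcvg_qprod s a c : (0 < c)%N ->
  fcvg (fun N => \prod_(k < N) (1 + (-1) ^+ s * 'q ^+ (a + c * k))) (qprod s a c).
Proof.
move=> c0; apply: (@fcvg_iprod (fun k => 1 + (-1) ^+ s * 'q ^+ (a + c * k))) => k.
rewrite -[X in eqmodX _ _ X]addr0 mulrC; apply: eqmodXD => //; apply: eqmodX_qX.
by nia.
Qed.

Lemma fcoef0_qprod s a c : (0 < a)%N -> (qprod s a c).[:0] = 1.
Proof.
move=> a0; apply: fcoef0_iprod.
by rewrite muln0 addn0 fcoefD mulrC fcoef_qXM a0 addr0.
Qed.

Lemma dil_qprod m s a c : (0 < m)%N -> (0 < c)%N ->
  dil m (qprod s a c) = qprod s (m * a) (m * c).
Proof.
move=> m0 c0; apply: fcvg_unique (fcvg_dil m0 (fcvg_qprod s a c0)) _.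
apply: fcvg_ext (fcvg_qprod s (m * a)%N (_ : 0 < m * c)%N) => [N|]; last by rewrite muln_gt0 m0.
rewrite rmorph_prod; apply: eq_bigr => k _.
rewrite rmorphD rmorph1 rmorphM rmorph_sign rmorphXn /= dil_q // -exprM.
by rewrite mulnDr mulnA.
Qed.

Lemma big_ord_mul (R : comNzRingType) m N (F : nat -> R) :
  \prod_(k < m * N) F k = \prod_(r < m) \prod_(k < N) F (r + m * k)%N.
Proof.
rewrite exchange_big /=; elim: N => [|N IH]; first by rewrite muln0 !big_ord0.
rewrite big_ord_recr /= -IH mulnSr big_split_ord; congr (_ * _).
by apply: eq_bigr => r _; rewrite /= addnC.
Qed.

Lemma fcvg_prod m (F : nat -> nat -> fps) (l : nat -> fps) :
  (forall r, fcvg (F r) (l r)) ->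
  fcvg (fun N => \prod_(r < m) F r N) (\prod_(r < m) l r).
Proof.
move=> cF; elim: m => [|m IH].
  by rewrite big_ord0; apply: fcvg_ext (fcvg_cst 1) => N; rewrite big_ord0.
rewrite big_ord_recr; apply: fcvg_ext (fcvgM IH (cF m)) => N.
by rewrite big_ord_recr.
Qed.

Lemma qprod_split m s a c : (0 < m)%N -> (0 < c)%N ->
  qprod s a c = \prod_(r < m) qprod s (a + c * r) (c * m).
Proof.
move=> m0 c0; have cm0 : (0 < c * m)%N by rewrite muln_gt0 c0.
have le_m n : (n <= m * n)%N by rewrite leq_pmull.
apply: fcvg_unique (fcvg_sub le_m (fcvg_qprod s a c0)) _.
pose F r N := \prod_(k < N) (1 + (-1) ^+ s * 'q ^+ (a + c * r + c * m * k)) : fps.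
have cF r : fcvg (F r) (qprod s (a + c * r) (c * m)) by apply: fcvg_qprod.
apply: (@fcvg_ext (fun N => \prod_(r < m) F r N)) => [N|].
  rewrite /= (big_ord_mul m N (fun k => 1 + (-1) ^+ s * 'q ^+ (a + c * k))).
  apply: eq_bigr => r _; apply: eq_bigr => k _.
  by congr (1 + _ * 'q ^+ _); lia.
exact: (@fcvg_prod m F (fun r => qprod s (a + c * r) (c * m))).
Qed.

Definition fE := qprod 1 1 1.

Lemma fcoef0_fE : fE.[:0] = 1. Proof. exact: fcoef0_qprod. Qed.
Lemma fcoef0_dil_fE k : (dil k fE).[:0] = 1.
Proof. by rewrite fcoef0_dil fcoef0_fE. Qed.

Lemma fcvg_theta_sum s a b : (0 < b)%N ->
  fcvg (theta_sum ((-1) ^+ s * 'q ^+ a) ((-1) ^+ s * 'q ^+ b))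
       (qprod s a (a + b) * qprod s b (a + b) * dil (a + b) fE).
Proof.
move=> b0; have ab0 : (0 < a + b)%N by rewrite addn_gt0 b0 orbT.
set x := _ * _; set y := _ * _.
have xy : x * y = 'q ^+ (a + b).
  by rewrite /x /y mulrACA -expr2 sqrr_sign mul1r exprD.
apply: triple_product.
- by rewrite /y mulrC fcoef_qXM b0.
- apply: fcvg_ext (fcvg_qprod s a ab0) => N; apply: eq_bigr => k _.
  by rewrite xy exprD exprM mulrA.
- apply: fcvg_ext (fcvg_qprod s b ab0) => N; apply: eq_bigr => k _.
  by rewrite xy exprD exprM mulrA.
rewrite /fE dil_qprod // muln1.
apply: fcvg_ext (fcvg_qprod 1 (a + b) ab0) => N; apply: eq_bigr => k _.
by rewrite xy -exprM mulnS mulN1r.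
Qed.

(* [locked] keeps ring-morphism rewriting from matching inside these products. *)
Definition phi := locked (qprod 1 1 2 ^+ 2 * dil 2 fE).
Definition psi := locked (qprod 0 1 1 ^+ 2 * fE).
(** [thA] and [thB] are Ramanujan's f(q, q^2) and f(-q, -q^5), the series A and B of the
    overview. *)
Definition thA := locked (qprod 0 1 3 * qprod 0 2 3 * dil 3 fE).
Definition thB := locked (qprod 1 1 6 * qprod 1 5 6 * dil 6 fE).

Lemma fcoef0_phi : phi.[:0] = 1.
Proof. by rewrite /phi -lock fcoefM0 fcoefX0 fcoef0_qprod // fcoef0_dil_fE. Qed.
Lemma fcvg_phi : fcvg (theta_sum (- 'q) (- 'q)) phi.
Proof.
have := @fcvg_theta_sum 1 1 1 isT; rewrite expr1 mulN1r.
by rewrite /phi -lock expr2.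
Qed.

Lemma fcvg_thB : fcvg (theta_sum (- 'q) (- 'q ^+ 5)) thB.
Proof. by have := @fcvg_theta_sum 1 1 5 isT; rewrite expr1 !mulN1r /thB -lock. Qed.

Lemma fcvg_thA : fcvg (theta_sum 'q ('q ^+ 2)) thA.
Proof. by have := @fcvg_theta_sum 0 1 2 isT; rewrite expr0 !mul1r /thA -lock. Qed.

Lemma qprod0 : qprod 0 0 1 = 2 * qprod 0 1 1.
Proof.
have le_S n : (n <= n.+1)%N by [].
apply: fcvg_unique (fcvg_sub le_S (fcvg_qprod 0 0 (ltn0Sn 0))) _.
apply: fcvg_ext (fcvgM (fcvg_cst 2) (fcvg_qprod 0 1 (ltn0Sn 0))) => N.
rewrite [RHS]big_ord_recl; by congr (_ * _); rewrite mul1r.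
Qed.

(** The bilateral sum of q^(n (n - 1)/2) meets each triangular number twice, at n and 1 - n; in the
    product the 2 is the factor 1 + q^0. *)
Lemma fcvg_psi : fcvg (theta_sum 1 'q) (2 * psi).
Proof.
have := @fcvg_theta_sum 0 0 1 isT; rewrite expr0 expr1 !mul1r qprod0 dil1.
by rewrite /psi -lock expr2 !mulrA.
Qed.

Lemma phi_dissect : phi = dil 9 phi - 2 * 'q * dil 3 thB.
Proof.
have le3 n : (n <= 3 * n + 1)%N by lia.
apply: fcvg_unique (fcvg_sub le3 fcvg_phi) _.
rewrite -mulNr; have := fcvgD (fcvg_dil (ltn0Sn 8) fcvg_phi)
  (fcvgM (fcvg_cst (- (2 * 'q))) (fcvg_dil (ltn0Sn 2) fcvg_thB)).
by apply: fcvg_ext => N; rewrite mulNr [RHS]theta_sum_phi3.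
Qed.

Lemma psi_dissect : psi = dil 3 thA + 'q * dil 9 psi.
Proof.
apply: (@fps_mulrnI 2) => //; rewrite -mulr_natl.
have le3 n : (n <= 3 * n + 1)%N by lia.
apply: fcvg_unique (fcvg_sub le3 fcvg_psi) _.
have -> : (dil 3 thA + 'q * dil 9 psi) *+ 2 = 2 * dil 3 thA + 'q * dil 9 (2 * psi).
  by rewrite [dil 9 (2 * psi)]rmorphM rmorph_nat /=; ring.
have := fcvgD (fcvgM (fcvg_cst 2) (fcvg_dil (ltn0Sn 2) fcvg_thA))
  (fcvgM (fcvg_cst 'q) (fcvg_dil (ltn0Sn 8) fcvg_psi)).
by apply: fcvg_ext => N; rewrite [RHS]theta_sum_psi3.
Qed.

Lemma qprod_fE : qprod 0 1 1 * fE = dil 2 fE.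
Proof.
rewrite [in RHS]/fE dil_qprod //.
apply: fcvg_unique (fcvgM (fcvg_qprod 0 1 (ltn0Sn 0)) (fcvg_qprod 1 1 (ltn0Sn 0))) _.
apply: fcvg_ext (fcvg_qprod 1 2 (ltn0Sn 1)) => N; rewrite -big_split.
apply: eq_bigr => k _ /=; rewrite (_ : 2 + 2 * k = (1 + 1 * k) * 2)%N; last by lia.
by rewrite exprM; ring.
Qed.

Lemma fE_split2 : fE = qprod 1 1 2 * dil 2 fE.
Proof.
rewrite {1}/fE (@qprod_split 2) // !big_ord_recl big_ord0 mulr1.
by rewrite /fE dil_qprod.
Qed.

Lemma fE_split3 : fE = qprod 1 1 3 * qprod 1 2 3 * dil 3 fE.
Proof.
rewrite {1}/fE (@qprod_split 3) // !big_ord_recl big_ord0 mulr1.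
by rewrite /fE dil_qprod // mulrA.
Qed.

Lemma qprod_split3 :
  qprod 0 1 1 = qprod 0 1 3 * qprod 0 2 3 * dil 3 (qprod 0 1 1).
Proof.
rewrite {1}(@qprod_split 3) // !big_ord_recl big_ord0 mulr1.
by rewrite dil_qprod // mulrA.
Qed.

Lemma qprod_odd_split3 :
  qprod 1 1 2 = qprod 1 1 6 * qprod 1 5 6 * dil 3 (qprod 1 1 2).
Proof.
rewrite {1}(@qprod_split 3) // !big_ord_recl big_ord0 mulr1.
by rewrite dil_qprod // mulrAC mulrA.
Qed.

Lemma phi_fE : phi * dil 2 fE = fE ^+ 2.
Proof. by rewrite /phi -lock [in RHS]fE_split2; ring. Qed.

Lemma psi_fE : psi * fE = dil 2 fE ^+ 2.
Proof. by rewrite /psi -lock -qprod_fE; ring. Qed.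

(** Splitting products modulo 3 gives A = (-q; q) E(q^3) / (-q^3; q^3) and B = (q; q^2) E(q^6) /
    (q^3; q^6); Euler's (-q; q) (q; q^2) = 1, at q and at q^3, removes the rest. *)
Lemma thA_thB : thA * thB = dil 3 (psi * phi).
Proof.
have E1 : thA * dil 3 (qprod 0 1 1) = qprod 0 1 1 * dil 3 fE.
  by rewrite [in RHS]qprod_split3 /thA -lock; ring.
have E2 : thB * dil 3 (qprod 1 1 2) = qprod 1 1 2 * dil 6 fE.
  by rewrite [in RHS]qprod_odd_split3 /thB -lock; ring.
have d6 : dil 6 fE = dil 3 (dil 2 fE) by rewrite dil_dil.
have P1 : qprod 0 1 1 * qprod 1 1 2 = 1.
  apply: (fps_mulI fcoef0_fE); rewrite mulr1 mulrA [fE * _]mulrC qprod_fE mulrC.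
  exact/esym/fE_split2.
have P3 : dil 3 (qprod 0 1 1) * dil 3 (qprod 1 1 2) = 1.
  by rewrite -rmorphM P1 rmorph1.
have -> : thA * thB = thA * dil 3 (qprod 0 1 1) * (thB * dil 3 (qprod 1 1 2)).
  by rewrite [RHS]mulrACA P3 mulr1.
rewrite E1 E2 mulrACA P1 mul1r d6 -rmorphM; congr (dil 3 _).
have -> : psi * phi = (qprod 0 1 1 * qprod 1 1 2) ^+ 2 * (fE * dil 2 fE).
  by rewrite /psi /phi -!lock; ring.
by rewrite P1; ring.
Qed.

Lemma norm3_qprod a : ~~ (3 %| a)%N -> norm3 (qprod 1 a 3) = qprod 1 a 3.
Proof.
move=> a3; apply: fcvg_unique (fcvg_norm3 (fcvg_qprod 1 a (ltn0Sn 2))) _.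
apply: fcvg_ext (fcvg_qprod 1 a (ltn0Sn 2)) => N.
rewrite (big_morph norm3 norm3M norm3_one); apply: eq_bigr => k _.
by rewrite mulN1r norm3_1BqX dvdn_addl ?dvdn_mulr // (negPf a3).
Qed.

(** Factors with exponent prime to 3 are preserved by the norm; the others form E(q^3), whose norm
    is E^3. *)
Lemma norm3_fE : norm3 fE * dil 3 fE = fE ^+ 4.
Proof.
have -> : norm3 fE = qprod 1 1 3 * qprod 1 2 3 * fE ^+ 3.
  by rewrite {1}fE_split3 !norm3M !norm3_qprod // norm3_dil3.
by rewrite mulrAC -fE_split3 -exprS.
Qed.

(** Apply the norm to phi = E(q)^2 / E(q^2), with denominators cleared by E(q^2)^4. *)
Lemma norm3_phi : norm3 phi * dil 3 phi = phi ^+ 4.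
Proof.
have E := norm3_fE; have E2 : norm3 (dil 2 fE) * dil 3 (dil 2 fE) = dil 2 fE ^+ 4.
  by rewrite norm3_dil2 !dil_dil // (mulnC 3) -(dil_dil 3) // -rmorphM E rmorphXn.
have F : norm3 phi * norm3 (dil 2 fE) = norm3 fE ^+ 2.
  by rewrite -norm3M phi_fE expr2 norm3M.
have F3 : dil 3 phi * dil 3 (dil 2 fE) = dil 3 fE ^+ 2.
  by rewrite -rmorphM phi_fE rmorphXn.
apply: (@fps_mulI (dil 2 fE ^+ 4)); first by rewrite fcoefX0 fcoef0_dil_fE.
transitivity (fE ^+ 8); last by rewrite -exprMn mulrC phi_fE -exprM.
rewrite -{1}E2.
have -> : norm3 (dil 2 fE) * dil 3 (dil 2 fE) * (norm3 phi * dil 3 phi) =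
  (norm3 phi * norm3 (dil 2 fE)) * (dil 3 phi * dil 3 (dil 2 fE)) by ring.
by rewrite F F3 -exprMn E -exprM.
Qed.

(** The norm is evaluated a second time, from the sections phi(q^3), -2 B, 0 of the dissection. *)
Lemma phi_quartic : phi ^+ 4 = dil 3 phi * (dil 3 phi ^+ 3 - 8 * 'q * thB ^+ 3).
Proof.
rewrite -norm3_phi mulrC; congr (_ * _); rewrite {1}phi_dissect.
have -> : dil 9 phi - 2 * 'q * dil 3 thB = dis3 (dil 3 phi) (- 2 * thB) 0.
  rewrite /dis3 dil_dil // [dil 3 (- 2 * thB)]rmorphM rmorphN rmorph_nat rmorph0 /=; ring.
by rewrite norm3_dis3; ring.
Qed.

(** * The generating function of [g] *)

Definition fps_of_poly (p : {poly int}) := Fps (fun n => p`_n).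

Fact fps_of_poly_additive : nmod_morphism fps_of_poly.
Proof.
split=> [|p r]; apply: fpsP => n; first by rewrite fcoef0 /= coef0.
by rewrite fcoefD /= coefD.
Qed.
Fact fps_of_poly_multiplicative : monoid_morphism fps_of_poly.
Proof.
split=> [|p r]; apply: fpsP => n; first by rewrite fcoef1 /= coef1.
by rewrite fcoefM /= coefM.
Qed.
HB.instance Definition _ := GRing.isNmodMorphism.Build {poly int} fps fps_of_poly
  fps_of_poly_additive.
HB.instance Definition _ := GRing.isMonoidMorphism.Build {poly int} fps fps_of_poly
  fps_of_poly_multiplicative.

Lemma fps_of_polyXn k : fps_of_poly 'X^k = 'q ^+ k.
Proof. by apply: fpsP => n; rewrite fcoef_qX /= coefXn. Qed.

Definition gf := psi ^+ 2 * phi^-1.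

Lemma phi_unit : phi \is a GRing.unit. Proof. exact: fps_unit_geom fcoef0_phi. Qed.

Lemma gf_fE : gf * fE ^+ 4 = dil 2 fE ^+ 5.
Proof.
have -> : gf * fE ^+ 4 = phi^-1 * fE ^+ 2 * (psi * fE) ^+ 2 by rewrite /gf; ring.
by rewrite -phi_fE mulKr ?phi_unit // psi_fE; ring.
Qed.

Lemma fE_trunc n : fE = \prod_(k < n) (1 - 'q ^+ k.+1) %[modX n.+1].
Proof.
pose u N : fps := \prod_(k < N) (1 - 'q ^+ k.+1).
have uD m : u (n + m)%N = u n %[modX n.+1].
  elim: m => [|m IH]; rewrite ?addn0 // addnS; apply: eqmodX_trans IH.
  rewrite /u big_ord_recr /= mulrBr mulr1 -[X in eqmodX _ _ X]subr0.
  apply: eqmodXD => //; apply: eqmodXN; rewrite mulrC; apply: eqmodX_qX; lia.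
have cu : fcvg u fE.
  apply: fcvg_ext (fcvg_qprod 1 1 (ltn0Sn 0)) => N; apply: eq_bigr => k _.
  by rewrite mulN1r mul1n.
have [N uN] := cu n.+1; apply: eqmodX_trans (uD N).
by apply/eqmodX_sym/uN/leq_addl.
Qed.

Lemma gfE n : gf.[:n] = g n.
Proof.
pose I := fps_of_poly (Einvtrunc n).
have ET : fps_of_poly (Etrunc n) = \prod_(k < n) (1 - 'q ^+ k.+1).
  rewrite /Etrunc big_add1 big_mkord rmorph_prod; apply: eq_bigr => k _.
  by rewrite rmorphB rmorph1 /= fps_of_polyXn.
have ET2 : fps_of_poly (Etrunc n \Po 'X^2) = dil 2 (\prod_(k < n) (1 - 'q ^+ k.+1)).
  rewrite /Etrunc big_add1 big_mkord !rmorph_prod /=; apply: eq_bigr => k _.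
  rewrite !rmorphB !rmorph1 /= comp_Xn_poly -exprM fps_of_polyXn.
  by rewrite [dil 2 _]rmorphXn /= dil_q // -exprM.
(* Each factor telescopes to 1 - q^(k (n + 1)), which is 1 modulo q^(n + 1). *)
have EI : fE * I = 1 %[modX n.+1].
  apply: (@eqmodX_trans _ (fps_of_poly (Etrunc n) * I)).
    by rewrite ET; apply: eqmodXM => //; apply: fE_trunc.
  rewrite -rmorphM /Etrunc /Einvtrunc -big_split rmorph_prod /=.
  apply: (@eqmodX_trans _ (\prod_(1 <= k < n.+1) 1)); last by rewrite big1_eq.
  apply: eqmodX_prod => k; rewrite mem_index_iota => /andP[k0 _] _.
  have -> : (1 - 'X^k) * \sum_(j < n.+1) 'X^(k * j) = 1 - 'X^k ^+ n.+1 :> {poly int}.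
    rewrite -[RHS]opprB subrX1 -mulNr opprB; congr (_ * _).
    by apply: eq_bigr => j _; rewrite exprM.
  rewrite rmorphB rmorph1 rmorphXn /= fps_of_polyXn -exprM.
  rewrite -[X in eqmodX _ _ X]subr0; apply: eqmodXD => //; apply: eqmodXN.
  rewrite -[_ ^+ _]mulr1; apply: eqmodX_qX; nia.
suff E : gf = fps_of_poly (((Etrunc n \Po 'X^2) ^+ 5) * (Einvtrunc n ^+ 4)) %[modX n.+1].
  exact: E.
(* Inserting a factor congruent to 1 lets [gf_fE] be used without dividing by [fE]. *)
apply: (@eqmodX_trans _ (gf * (fE * I) ^+ 4)).
  rewrite -{1}[gf]mulr1 -(expr1n _ 4); apply: eqmodXM => //.
  exact/eqmodX_exp/eqmodX_sym.
rewrite exprMn mulrA gf_fE rmorphM !rmorphXn /= -/I ET2.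
apply: eqmodXM => //; apply: eqmodX_exp; apply: eqmodX_dil => //; exact: fE_trunc.
Qed.

(** * Action of the dissection operators on powers of [T] *)

Local Notation phi3 := (dil 3 phi).
Local Notation psi3 := (dil 3 psi).

Definition fT := phi3 ^+ 4 * phi^-1 ^+ 4.
Definition rho := dil 9 phi * phi^-1.
Definition gf3 := psi3 ^+ 2 * phi3^-1.

Lemma phiV : phi * phi^-1 = 1. Proof. exact: mulrV phi_unit. Qed.
Lemma phi3_unit : phi3 \is a GRing.unit.
Proof. by apply: fps_unit_geom; rewrite fcoef0_dil fcoef0_phi. Qed.
Lemma phi3V : phi3 * phi3^-1 = 1. Proof. exact: mulrV phi3_unit. Qed.
Lemma dil3_phiV : dil 3 phi^-1 = phi3^-1.
Proof. by rewrite rmorphV ?phi_unit. Qed.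
Lemma dil3_phi3 : dil 3 phi3 = dil 9 phi.
Proof. by rewrite dil_dil. Qed.

Lemma dil3_quartic :
  phi3 ^+ 4 = dil 9 phi * (dil 9 phi ^+ 3 - 8 * 'q ^+ 3 * dil 3 thB ^+ 3).
Proof.
have := congr1 (dil 3) phi_quartic.
rewrite !(rmorphXn, rmorphM, rmorphB, rmorph_nat) /= dil3_phi3 dil_q //.
Qed.

Lemma rho_cubic : rho ^+ 3 = dil 3 fT * (3 * rho ^+ 2 - 3 * rho + 1).
Proof.
have := dil3_quartic; have := phi_dissect.
have -> : dil 3 fT = dil 9 phi ^+ 4 * phi3^-1 ^+ 4.
  by rewrite !(rmorphXn, rmorphM) /= dil3_phi3 dil3_phiV.
rewrite /rho; move: phiV phi3V.
set a := dil 9 phi; set b := dil 3 thB; set i := phi^-1; set j := phi3^-1.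
set p := phi3; move=> pi pj def_phi quart.
have -> : 3 * (a * i) ^+ 2 - 3 * (a * i) + 1 =
    i ^+ 3 * (3 * a ^+ 2 * phi - 3 * a * phi ^+ 2 + phi ^+ 3).
  have -> : i ^+ 3 * (3 * a ^+ 2 * phi - 3 * a * phi ^+ 2 + phi ^+ 3) =
    3 * a ^+ 2 * i ^+ 2 * (phi * i) - 3 * a * i * (phi * i) ^+ 2 + (phi * i) ^+ 3 by ring.
  by rewrite pi; ring.
(* Since 2 q b = a - phi, the quartic reads p^4 = a (a^3 - (a - phi)^3). *)
have E : a * (3 * a ^+ 2 * phi - 3 * a * phi ^+ 2 + phi ^+ 3) = p ^+ 4.
  by rewrite quart def_phi; ring.
have -> : a ^+ 4 * j ^+ 4 * (i ^+ 3 * (3 * a ^+ 2 * phi - 3 * a * phi ^+ 2 + phi ^+ 3)) =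
  (a * i) ^+ 3 * j ^+ 4 * (a * (3 * a ^+ 2 * phi - 3 * a * phi ^+ 2 + phi ^+ 3)) by ring.
by rewrite E -mulrA -exprMn mulrC [j * p]mulrC pj; ring.
Qed.

(** The coefficients of the cubic are series in q^3 and pass through [usec]. The weight [w] will be
    [psi ^+ 2] or 1. *)
Lemma usec_rho_rec r w m : (r < 3)%N ->
  usec 3 r (w * rho ^+ (m + 3)) = fT * (3 * usec 3 r (w * rho ^+ (m + 2)) -
    3 * usec 3 r (w * rho ^+ (m + 1)) + usec 3 r (w * rho ^+ m)).
Proof.
move=> r3.
have -> : w * rho ^+ (m + 3) = dil 3 fT * (w * rho ^+ (m + 2) *+ 3
   - w * rho ^+ (m + 1) *+ 3 + w * rho ^+ m).
  by rewrite exprD rho_cubic !exprD; ring.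
by rewrite usec_dilM // !(raddfD, raddfB, raddfMn) /=; ring.
Qed.

(** This rationalises 1/phi: a^3 - (2 q b)^3 has the factor a - 2 q b = phi, and [dil3_quartic]
    identifies the whole. *)
Lemma rho_dis3 : rho = dil 3 (phi3 ^+ 2 * phi^-1 ^+ 4) *
  dis3 (phi3 ^+ 2) (2 * phi3 * thB) (4 * thB ^+ 2).
Proof.
have := dil3_quartic; have := phi_dissect.
rewrite /dis3 !(rmorphXn, rmorphM, rmorph_nat) /= dil3_phi3 dil3_phiV /rho.
move: phiV phi3V.
set a := dil 9 phi; set b := dil 3 thB; set i := phi^-1; set j := phi3^-1.
set p := phi3; move=> pi pj def_phi quart.
have pj4 : p ^+ 4 * j ^+ 4 = 1 by rewrite -exprMn pj expr1n.
rewrite -[LHS]mulr1 -[X in _ * X = _]pj4 quart.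
have -> : a * i * (a * (a ^+ 3 - 8 * 'q ^+ 3 * b ^+ 3) * j ^+ 4) =
  a ^+ 2 * j ^+ 4 * (a ^+ 2 + 2 * 'q * a * b + 4 * 'q ^+ 2 * b ^+ 2) *
   ((a - 2 * 'q * b) * i) by ring.
by rewrite -def_phi pi; ring.
Qed.

Lemma psi_sqr_dis3 : psi ^+ 2 = dis3 (thA ^+ 2) (2 * thA * psi3) (psi3 ^+ 2).
Proof.
have {1}-> : psi = dis3 thA psi3 0.
  by rewrite /dis3 rmorph0 dil_dil // {1}psi_dissect; ring.
by rewrite expr2 dis3M; congr dis3; ring.
Qed.

(** Divided by phi^4, the right side is T - 1; this is how B^3 is eliminated in favour of T. *)
Lemma thB_cubic : 8 * 'q * phi3 * thB ^+ 3 = phi3 ^+ 4 - phi ^+ 4.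
Proof. by rewrite phi_quartic; ring. Qed.

Lemma rho_sqr_dis3 : rho ^+ 2 = dil 3 (phi3 ^+ 4 * phi^-1 ^+ 8) *
  dis3 (phi3 ^+ 4 + 16 * 'q * phi3 * thB ^+ 3)
       (4 * phi3 ^+ 3 * thB + 16 * 'q * thB ^+ 4) (12 * phi3 ^+ 2 * thB ^+ 2).
Proof.
rewrite rho_dis3 exprMn [dis3 _ _ _ ^+ 2]expr2 dis3M -rmorphXn /=.
by congr (dil 3 _ * dis3 _ _ _); ring.
Qed.

Lemma usec0_rho0 : usec 3 0 (rho ^+ 0) = 1.
Proof. by rewrite expr0 -[X in usec _ _ X](rmorph1 (dil 3)) usec_dil. Qed.

Lemma usec0_rho1 : usec 3 0 rho = fT.
Proof. by rewrite rho_dis3 usec_dilM // usec_dis3 /fT; ring. Qed.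

Lemma usec0_rho2 : usec 3 0 (rho ^+ 2) = 3 * fT ^+ 2 - 2 * fT.
Proof.
rewrite rho_sqr_dis3 usec_dilM // usec_dis3.
have -> : 16 * 'q * phi3 * thB ^+ 3 = 2 * (8 * 'q * phi3 * thB ^+ 3) by ring.
rewrite thB_cubic /fT.
have -> : phi3 ^+ 4 * phi^-1 ^+ 8 * (phi3 ^+ 4 + 2 * (phi3 ^+ 4 - phi ^+ 4)) =
  3 * (phi3 ^+ 4 * phi^-1 ^+ 4) ^+ 2
  - 2 * (phi3 ^+ 4 * phi^-1 ^+ 4) * (phi * phi^-1) ^+ 4 by ring.
by rewrite phiV; ring.
Qed.

Lemma usec2_psi_rho0 : usec 3 2 (psi ^+ 2) = psi3 ^+ 2.
Proof. by rewrite psi_sqr_dis3 usec_dis3. Qed.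

(** In this residue class A and B occur to equal powers, so AB = psi(q^3) phi(q^3) applies; 9 is 4 +
    4 + 1. *)
Lemma usec2_psi_rho1 : usec 3 2 (psi ^+ 2 * rho) = psi3 ^+ 2 * (9 * fT).
Proof.
rewrite psi_sqr_dis3 rho_dis3 mulrCA usec_dilM // dis3M usec_dis3 /fT.
have AB : thA * thB = psi3 * phi3 by rewrite thA_thB rmorphM.
have -> : thA ^+ 2 * (4 * thB ^+ 2) + 2 * thA * psi3 * (2 * phi3 * thB) +
    psi3 ^+ 2 * phi3 ^+ 2 =
  4 * (thA * thB) ^+ 2 + 4 * psi3 * phi3 * (thA * thB) + psi3 ^+ 2 * phi3 ^+ 2 by ring.
by rewrite AB; ring.
Qed.

Lemma usec2_psi_rho2 :
  usec 3 2 (psi ^+ 2 * rho ^+ 2) = psi3 ^+ 2 * (27 * fT ^+ 2 - 6 * fT).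
Proof.
rewrite psi_sqr_dis3 rho_sqr_dis3 mulrCA usec_dilM // dis3M usec_dis3 /fT.
have AB : thA * thB = psi3 * phi3 by rewrite thA_thB rmorphM.
set X := (X in _ * X = _).
have -> : X = 12 * phi3 ^+ 2 * (thA * thB) ^+ 2
   + (8 * psi3 * phi3 ^+ 3 + 32 * 'q * psi3 * thB ^+ 3) * (thA * thB)
   + psi3 ^+ 2 * (phi3 ^+ 4 + 16 * 'q * phi3 * thB ^+ 3) by rewrite /X; ring.
rewrite {X} AB.
set X := (X in _ * X = _).
have -> : X = psi3 ^+ 2 * (21 * phi3 ^+ 4 + 6 * (8 * 'q * phi3 * thB ^+ 3)).
  by rewrite /X; ring.
rewrite thB_cubic {X}.
have -> : phi3 ^+ 4 * phi^-1 ^+ 8 *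
    (psi3 ^+ 2 * (21 * phi3 ^+ 4 + 6 * (phi3 ^+ 4 - phi ^+ 4))) =
  psi3 ^+ 2 * (27 * (phi3 ^+ 4 * phi^-1 ^+ 4) ^+ 2
  - 6 * (phi3 ^+ 4 * phi^-1 ^+ 4) * (phi * phi^-1) ^+ 4) by ring.
by rewrite phiV; ring.
Qed.

(** * Coefficient polynomials in T and their 3-adic valuations *)

Fixpoint rec3 (a b c : {poly int}) m :=
  if m is m'.+1 then rec3 b c ('X * (3 * c - 3 * b + a)) m' else a.

Lemma rec3E a b c m : rec3 a b c (m + 3) =
  'X * (3 * rec3 a b c (m + 2) - 3 * rec3 a b c (m + 1) + rec3 a b c m).
Proof. by elim: m a b c => [|m IH] a b c //; rewrite !addSn /= IH. Qed.

Definition dpoly := rec3 1 (9 * 'X) (27 * 'X^2 - 6 * 'X).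
Definition epoly := rec3 1 'X (3 * 'X^2 - 2 * 'X).

Definition evT : {poly int} -> fps := horner_eval fT \o map_poly intr.

HB.instance Definition _ :=
  GRing.RMorphism.copy evT (horner_eval fT \o map_poly intr).

Lemma evTX : evT 'X = fT.
Proof. by rewrite /evT /= map_polyX /horner_eval hornerX. Qed.

Lemma evTE p : evT p = \sum_(k < size p) fT ^+ k *~ p`_k.
Proof.
rewrite /evT /= /horner_eval (@horner_coef_wide _ (size p)) ?size_poly //.
by apply: eq_bigr => k _; rewrite coef_map /= mulrzl.
Qed.

Lemma ind3 (P : nat -> Prop) : P 0%N -> P 1%N -> P 2%N ->
  (forall m, P m -> P m.+1 -> P m.+2 -> P m.+3) -> forall m, P m.
Proof.
move=> P0 P1 P2 PS m; suff [] : [/\ P m, P m.+1 & P m.+2] by [].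
by elim: m => // m [Pm Pm1 Pm2]; split=> //; apply: PS.
Qed.

Lemma coef_rec3 a b c m l : (rec3 a b c (m + 3))`_l = if l is l'.+1 then
  3 * (rec3 a b c (m + 2))`_l' - 3 * (rec3 a b c (m + 1))`_l' + (rec3 a b c m)`_l'
  else 0.
Proof.
rewrite rec3E coefXM; case: l => // l.
by rewrite coefD coefB !mulr_natl !coefMn.
Qed.

(** Every three indices the recurrence contributes one factor ['X]. This later permits division by a
    power of T. *)
Lemma rec3_support (a b c : {poly int}) m l :
  b`_0 = 0 -> c`_0 = 0 ->
  (3 * l < m)%N -> (rec3 a b c m)`_l = 0.
Proof.
move=> b0 c0; elim/ind3: m l => [|l|l|m IH0 IH1 IH2 l lt_l] //.
- by case: l => //; lia.
- by case: l => //; lia.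
rewrite -addn3 coef_rec3; case: l lt_l => // l lt_l.
by rewrite addn2 addn1 IH0 ?IH1 ?IH2 ?mulr0 ?subrr ?addr0 //; lia.
Qed.

(** Going from (m + 3, l + 1) to (m, l) keeps the bound; going to (m + 1, l) or (m + 2, l) lowers it
    by at most 1, which the coefficient 3 restores. *)
Lemma rec3_val a b c s :
  (forall m l, (m < 3)%N -> ((3 ^ (3 * l + 1 - (m + s))./2)%:Z %| (rec3 a b c m)`_l)%Z) ->
  forall m l, ((3 ^ (3 * l + 1 - (m + s))./2)%:Z %| (rec3 a b c m)`_l)%Z.
Proof.
move=> init m; elim/ind3: m => [l|l|l|m IH0 IH1 IH2 l]; try exact: init.
rewrite -[m.+3]addn3 coef_rec3 addn2 addn1; case: l => [|l]; first exact: dvdz0.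
have le3 p q (x : int) : (p <= q.+1)%N -> ((3 ^ q)%:Z %| x)%Z -> ((3 ^ p)%:Z %| 3 * x)%Z.
  move=> le_pq /dvdzP[y ->]; apply: (@dvdz_trans (3 ^ q.+1)%:Z).
    by apply/dvdzP; exists (3 ^ (q.+1 - p))%:Z; rewrite -PoszM -expnD subnK.
  by apply/dvdzP; exists y; rewrite expnS PoszM; ring.
apply: rpredD; first apply: rpredB.
- by apply: le3 (IH2 l); lia.
- by apply: le3 (IH1 l); lia.
have -> : (3 * l.+1 + 1 - (m + 3 + s) = 3 * l + 1 - (m + s))%N by lia.
exact: IH0.
Qed.

Lemma dpoly_support m l : (3 * l < m)%N -> (dpoly m)`_l = 0.
Proof.
by apply: rec3_support => //; rewrite ?coefB !mulr_natl !coefMn ?coefXn ?coefX ?mul0rn ?subrr.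
Qed.
Lemma epoly_support m l : (3 * l < m)%N -> (epoly m)`_l = 0.
Proof.
by apply: rec3_support => //; rewrite ?coefB ?mulr_natl ?coefMn ?coefXn ?coefX ?mul0rn ?subrr.
Qed.

Lemma dpoly_val m l : ((3 ^ (3 * l + 1 - m)./2)%:Z %| (dpoly m)`_l)%Z.
Proof.
rewrite -[X in (_ - X)%N]addn0; apply: rec3_val => {m l} -[|[|[|]]] //= l _.
- by rewrite coef1; case: l => [|l] //; exact: dvdz0.
- rewrite mulr_natl coefMn coefX; case: l => [|[|l]] //=; exact: dvdz0.
- by rewrite coefB !mulr_natl !coefMn coefXn coefX; case: l => [|[|[|l]]] //=; exact: dvdz0.
Qed.

(** The offset 2 is forced by the entry ['X] at [m = 1], whose coefficient is prime to 3. *)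
Lemma epoly_val m l : ((3 ^ (3 * l + 1 - (m + 2))./2)%:Z %| (epoly m)`_l)%Z.
Proof.
apply: rec3_val => {m l} -[|[|[|]]] //= l _.
- by rewrite coef1; case: l => [|l] //; exact: dvdz0.
- rewrite coefX; case: l => [|[|l]] //=; exact: dvdz0.
- by rewrite coefB !mulr_natl !coefMn coefXn coefX; case: l => [|[|[|l]]] //=; exact: dvdz0.
Qed.

Lemma dpolyS m l : (dpoly m.+3)`_l.+1 =
  3 * (dpoly m.+2)`_l - 3 * (dpoly m.+1)`_l + (dpoly m)`_l.
Proof. by rewrite -addn3 coef_rec3 addn1 addn2. Qed.

Lemma epolyS m l : (epoly m.+3)`_l.+1 =
  3 * (epoly m.+2)`_l - 3 * (epoly m.+1)`_l + (epoly m)`_l.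
Proof. by rewrite -addn3 coef_rec3 addn1 addn2. Qed.

(* The general bounds [dpoly_val] and [epoly_val] are one power of 3 short here. *)
Lemma dpoly5_2 : (dpoly 5)`_2 = -9.
Proof.
have d00 : (dpoly 0)`_0 = 1 by rewrite /= coef1.
have d21 : (dpoly 2)`_1 = -6 by rewrite /= coefB !mulr_natl !coefMn coefXn coefX.
have d31 : (dpoly 3)`_1 = 1 by rewrite dpolyS d00 !(@dpoly_support _ 0) //; ring.
by rewrite dpolyS d31 d21 (@dpoly_support 4 1) //; ring.
Qed.

Lemma epoly8_4 : (epoly 8)`_4 = 306.
Proof.
have e00 : (epoly 0)`_0 = 1 by rewrite /= coef1.
have e01 : (epoly 0)`_1 = 0 by rewrite /= coef1.
have e11 : (epoly 1)`_1 = 1 by rewrite /= coefX.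
have e21 : (epoly 2)`_1 = -2 by rewrite /= coefB !mulr_natl !coefMn coefXn coefX.
have e22 : (epoly 2)`_2 = 3 by rewrite /= coefB !mulr_natl !coefMn coefXn coefX.
have e31 : (epoly 3)`_1 = 1 by rewrite epolyS e00 !(@epoly_support _ 0) //; ring.
have e32 : (epoly 3)`_2 = -9 by rewrite epolyS e21 e11 e01; ring.
have e42 : (epoly 4)`_2 = 10 by rewrite epolyS e31 e21 e11; ring.
have e52 : (epoly 5)`_2 = -5 by rewrite epolyS e31 e21 (@epoly_support 4 1) //; ring.
have e53 : (epoly 5)`_3 = 60 by rewrite epolyS e42 e32 e22; ring.
have e62 : (epoly 6)`_2 = 1.
  by rewrite epolyS e31 (@epoly_support 5 1) // (@epoly_support 4 1) //; ring.
have e63 : (epoly 6)`_3 = -54 by rewrite epolyS e52 e42 e32; ring.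
have e73 : (epoly 7)`_3 = 28 by rewrite epolyS e62 e52 e42; ring.
by rewrite epolyS e73 e63 e53; ring.
Qed.

Lemma evT_rec3 a b c m : evT (rec3 a b c m.+3) = fT * (3 * evT (rec3 a b c m.+2)
  - 3 * evT (rec3 a b c m.+1) + evT (rec3 a b c m)).
Proof.
rewrite -addn3 rec3E rmorphM /= evTX rmorphD rmorphB !rmorphM !rmorph_nat /=.
by rewrite addn2 addn1.
Qed.

Lemma usec2_psi_rho m :
  usec 3 2 (psi ^+ 2 * rho ^+ m) = dil 3 psi ^+ 2 * evT (dpoly m).
Proof.
elim/ind3: m => [|||m IH0 IH1 IH2].
- by rewrite mulr1 usec2_psi_rho0 rmorph1 mulr1.
- by rewrite usec2_psi_rho1 /= rmorphM rmorph_nat /= evTX.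
- by rewrite usec2_psi_rho2 /= rmorphB !(rmorphXn, rmorphM, rmorph_nat) /= evTX.
rewrite -{1}[m.+3]addn3 usec_rho_rec // addn2 addn1 IH0 IH1 IH2 /dpoly evT_rec3.
by ring.
Qed.

Lemma usec0_rho m : usec 3 0 (rho ^+ m) = evT (epoly m).
Proof.
elim/ind3: m => [|||m IH0 IH1 IH2].
- by rewrite usec0_rho0 rmorph1.
- by rewrite usec0_rho1 evTX.
- by rewrite usec0_rho2 /= rmorphB !(rmorphXn, rmorphM, rmorph_nat) /= evTX.
rewrite -{1}[m.+3]addn3 -[rho ^+ _]mul1r usec_rho_rec // !mul1r addn2 addn1.
by rewrite IH0 IH1 IH2 /epoly evT_rec3.
Qed.

(** * The dissection operators on [gf] and [gf3] times polynomials in T *)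

Lemma fT_inj j : injective ( *%R (fT ^+ j)).
Proof.
apply: fps_mulI; rewrite fcoefX0 /fT fcoefM0 !fcoefX0 fcoef0_dil fcoef0_phi.
have : (phi * phi^-1).[:0] = 1 by rewrite phiV.
by rewrite fcoefM0 fcoef0_phi mul1r => ->; rewrite !expr1n.
Qed.

(** F T^j is psi^2 rho^(4j + 1) times a series in q^3; pulled out of the section, that series
    contributes T^(-j), which is kept on the left as [fT ^+ j]. *)
Lemma usec2_gfM j : fT ^+ j * usec 3 2 (gf * fT ^+ j) = gf3 * evT (dpoly (4 * j + 1)).
Proof.
have -> : gf * fT ^+ j =
  dil 3 (phi ^+ (4 * j) * (dil 3 phi)^-1 ^+ (4 * j + 1)) *
    (psi ^+ 2 * rho ^+ (4 * j + 1)).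
  rewrite rmorphM !rmorphXn /= rmorphV ?phi3_unit //= dil3_phi3.
  rewrite /gf /fT /rho [RHS]mulrACA; move: phi^-1 => i.
  have a9 : (dil 9 phi)^-1 * dil 9 phi = 1.
    by rewrite mulVr // -dil3_phi3; apply: rmorph_unit; apply: phi3_unit.
  have -> : (dil 9 phi)^-1 ^+ (4 * j + 1) * (dil 9 phi * i) ^+ (4 * j + 1) = i ^+ (4 * j + 1).
    by rewrite -exprMn mulrA a9 mul1r.
  by rewrite exprMn -!exprM exprD expr1; ring.
rewrite usec_dilM // usec2_psi_rho /gf3 /fT exprMn -!exprM.
have p1 : phi^-1 ^+ (4 * j) * phi ^+ (4 * j) = 1 by rewrite -exprMn mulrC phiV expr1n.
have p3 : dil 3 phi ^+ (4 * j) * (dil 3 phi)^-1 ^+ (4 * j) = 1.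
  by rewrite -exprMn phi3V expr1n.
rewrite exprD expr1; move: p1 p3.
move: (phi^-1 ^+ _) (phi ^+ _) (dil 3 phi ^+ _) ((dil 3 phi)^-1 ^+ _) => a b c d ab cd.
transitivity ((a * b) * (c * d) * (dil 3 psi ^+ 2 * (dil 3 phi)^-1 * evT (dpoly (4 * j + 1)))).
  by ring.
by rewrite ab cd !mul1r.
Qed.

Lemma usec0_gf3M k : fT ^+ k * usec 3 0 (gf3 * fT ^+ k) = gf * evT (epoly (4 * k)).
Proof.
have -> : gf3 * fT ^+ k =
  dil 3 (gf * phi ^+ (4 * k) * (dil 3 phi)^-1 ^+ (4 * k)) * rho ^+ (4 * k).
  rewrite /gf !rmorphM !rmorphXn /= !rmorphV ?phi3_unit ?phi_unit //= dil3_phi3.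
  rewrite /gf3 /fT /rho -[RHS]mulrA; move: phi^-1 => i.
  have a9 : (dil 9 phi)^-1 * dil 9 phi = 1.
    by rewrite mulVr // -dil3_phi3; apply: rmorph_unit; apply: phi3_unit.
  have -> : (dil 9 phi)^-1 ^+ (4 * k) * (dil 9 phi * i) ^+ (4 * k) = i ^+ (4 * k).
    by rewrite -exprMn mulrA a9 mul1r.
  by rewrite exprMn -!exprM !mulrA.
rewrite usec_dilM // usec0_rho /fT exprMn -!exprM.
have p1 : phi^-1 ^+ (4 * k) * phi ^+ (4 * k) = 1 by rewrite -exprMn mulrC phiV expr1n.
have p3 : dil 3 phi ^+ (4 * k) * (dil 3 phi)^-1 ^+ (4 * k) = 1.
  by rewrite -exprMn phi3V expr1n.
move: p1 p3.
move: (phi^-1 ^+ _) (phi ^+ _) (dil 3 phi ^+ _) ((dil 3 phi)^-1 ^+ _) => a b c d ab cd.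
transitivity ((a * b) * (c * d) * (gf * evT (epoly (4 * k)))); first by ring.
by rewrite ab cd !mul1r.
Qed.

Lemma evT_drop j (p : {poly int}) : (forall l, (l < j)%N -> p`_l = 0) ->
  evT p = fT ^+ j * evT (drop_poly j p).
Proof.
move=> p0; rewrite -{1}(poly_take_drop j p) rmorphD rmorphM rmorphXn /= evTX.
have -> : take_poly j p = 0.
  apply/polyP => l; rewrite coef_take_poly coef0.
  by case: ltnP => // /p0.
by rewrite rmorph0 add0r mulrC.
Qed.

Lemma usec2_gfMT j : usec 3 2 (gf * fT ^+ j) = gf3 * evT (drop_poly j (dpoly (4 * j + 1))).
Proof.
apply: (@fT_inj j); rewrite usec2_gfM mulrCA -evT_drop // => l lt_lj.
by apply: dpoly_support; lia.
Qed.

Lemma usec0_gf3MT k : usec 3 0 (gf3 * fT ^+ k) = gf * evT (drop_poly k (epoly (4 * k))).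
Proof.
apply: (@fT_inj k); rewrite usec0_gf3M mulrCA -evT_drop // => l lt_lj.
by apply: epoly_support; lia.
Qed.

(** [step2] and [step0] are the matrices of the two operators acting on coefficient vectors in
    powers of T. *)
Definition step2 (c : {poly int}) : {poly int} :=
  \sum_(i < size c) drop_poly i (dpoly (4 * i + 1)) *~ c`_i.
Definition step0 (c : {poly int}) : {poly int} :=
  \sum_(k < size c) drop_poly k (epoly (4 * k)) *~ c`_k.

Lemma usec2_gf_evT c : usec 3 2 (gf * evT c) = gf3 * evT (step2 c).
Proof.
rewrite evTE mulr_sumr !raddf_sum mulr_sumr; apply: eq_bigr => i _ /=.
by rewrite mulrzAr !raddfMz /= usec2_gfMT mulrzAr.
Qed.

Lemma usec0_gf3_evT c : usec 3 0 (gf3 * evT c) = gf * evT (step0 c).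
Proof.
rewrite evTE mulr_sumr !raddf_sum mulr_sumr; apply: eq_bigr => i _ /=.
by rewrite mulrzAr !raddfMz /= usec0_gf3MT mulrzAr.
Qed.

Lemma coef_step2 c k : (step2 c)`_k = \sum_(i < size c) c`_i * (dpoly (4 * i + 1))`_(k + i).
Proof.
rewrite coef_sum; apply: eq_bigr => i _.
by rewrite coefMrz coef_drop_poly -mulrzl intz.
Qed.

Lemma coef_step0 c i : (step0 c)`_i = \sum_(k < size c) c`_k * (epoly (4 * k))`_(i + k).
Proof.
rewrite coef_sum; apply: eq_bigr => k _.
by rewrite coefMrz coef_drop_poly -mulrzl intz.
Qed.

(** * 3-adic invariants and the iteration *)

Lemma dvdz_exp3M p r s (x y : int) : (s <= p + r)%N ->
  ((3 ^ p)%:Z %| x)%Z -> ((3 ^ r)%:Z %| y)%Z -> ((3 ^ s)%:Z %| x * y)%Z.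
Proof.
move=> le_s dx dy; apply: (@dvdz_trans ((3 ^ p)%:Z * (3 ^ r)%:Z)).
  by rewrite -PoszM -expnD; apply: dvdn_exp2l.
exact: dvdz_mul.
Qed.

(* Invariants of the iteration: [mu] bounds the extra 3-adic valuation of the
   coefficients in [G Z[T]], [nu] that of the coefficients in [F Z[T]]. *)
Definition mu k := ((3 * k - 5)./2)%N.
Definition nu i := (if (i <= 1)%N then 0 else i)%N.

Definition val_odd e (c : {poly int}) :=
  c`_0 = 0 /\ forall k, ((3 ^ (e + mu k))%:Z %| c`_k)%Z.
Definition val_even e (c : {poly int}) :=
  c`_0 = 0 /\ forall i, ((3 ^ (e + nu i))%:Z %| c`_i)%Z.

(** No power of 3 is gained in [e] here; the profile [mu] is only exchanged for [nu]. *)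
Lemma val_step0 e c : val_odd e c -> val_even e (step0 c).
Proof.
move=> [c0 vc]; split=> [|i]; rewrite coef_step0.
  apply: big1 => -[[|k] lt_k] _ /=; first by rewrite c0 mul0r.
  by rewrite epoly_support ?mulr0 //; lia.
apply: rpred_sum => -[k lt_k] _ /=.
have [->|k0] := posnP k; first by rewrite c0 mul0r dvdz0.
have [lt_ik|le_ki] := ltnP (3 * i) k.
  by rewrite epoly_support ?mulr0 ?dvdz0 //; lia.
(* The one entry where [epoly_val] falls short: it yields 3, while [nu 2] asks for 9, and 306 = 9 *
   34. *)
have [[-> ->]|special] : (k = 2 /\ i = 2) \/ ~ (k = 2 /\ i = 2) by lia.
  by rewrite epoly8_4; apply: (@dvdz_exp3M (e + mu 2) 2) => //; rewrite /mu /nu /=; lia.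
apply: (dvdz_exp3M _ (vc k) (epoly_val (4 * k) (i + k))).
by rewrite /mu /nu; case: ifP => ?; lia.
Qed.

(** Exchanging [nu] back for [mu] frees two powers of 3: (3k - i)/2 plus [nu i] exceeds [mu k] by 2
    up to rounding. *)
Lemma val_step2 e c : val_even e c -> val_odd (e + 2) (step2 c).
Proof.
move=> [c0 vc]; split=> [|k]; rewrite coef_step2.
  by apply: big1 => -[i lt_i] _ /=; rewrite dpoly_support ?mulr0 //; lia.
apply: rpred_sum => -[i lt_i] _ /=.
have [->|i0] := posnP i; first by rewrite c0 mul0r dvdz0.
have [lt_ki|le_ik] := ltnP (3 * k) i.+1.
  by rewrite dpoly_support ?mulr0 ?dvdz0 //; lia.
have [[-> ->]|special] : (i = 1 /\ k = 1) \/ ~ (i = 1 /\ k = 1) by lia.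
  by rewrite dpoly5_2; apply: (@dvdz_exp3M (e + nu 1) 2) => //; rewrite /mu /nu /=; lia.
apply: (dvdz_exp3M _ (vc i) (dpoly_val (4 * i + 1) (k + i))).
by rewrite /mu /nu; case: ifP => ?; lia.
Qed.

Lemma gf_iter a : exists2 c, val_odd (2 * a.+1) c &
  iter a (usec 3 2 \o usec 3 0) (usec 3 2 gf) = gf3 * evT c.
Proof.
elim: a => [|a [c vc IH]].
  (* The case [j = 0] gives G d_1(T) with d_1 = 9 X, which supplies the first two powers of 3. *)
  exists (dpoly 1); last by have := usec2_gfM 0; rewrite expr0 mul1r mulr1.
  have d1 k : (dpoly 1)`_k = (k == 1%N)%:R *+ 9 by rewrite /dpoly /= mulr_natl coefMn coefX.
  by split=> [|[|[|k]]]; rewrite d1 //= mul0rn dvdz0.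
exists (step2 (step0 c)); last by rewrite iterS /= IH usec0_gf3_evT usec2_gf_evT.
by rewrite mulnS addnC; apply/val_step2/val_step0.
Qed.

Lemma fcoef_iter a n :
  (iter a (usec 3 2 \o usec 3 0) (usec 3 2 gf)).[:n] =
  g (3 ^ (2 * a + 1) * n + (3 ^ (2 * a.+1) - 1) %/ 4).
Proof.
pose H a := iter a (usec 3 2 \o usec 3 0) (usec 3 2 gf).
rewrite -/(H a); elim: a n => [|a IH] n.
  by rewrite -[H 0%N]/(usec 3 2 gf) fcoef_usec gfE; congr g; lia.
rewrite -[H a.+1]/(usec 3 2 (usec 3 0 (H a))) !fcoef_usec IH; congr g.
(* One round sends n to 9 n + 6, and 6 * 3^(2a + 1) = 2 * 9^(a + 1) is the increment of (9^(a + 1) -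
   1)/4; exact divisibility by 4 justifies the truncated quotient. *)
have : (4 %| 3 ^ (2 * a.+1) - 1)%N.
  by rewrite expnM; elim: (a.+1) => // b IHb; rewrite expnS; lia.
have : (0 < 3 ^ (2 * a.+1))%N by rewrite expn_gt0.
rewrite (_ : 2 * a.+2 = 2 + 2 * a.+1)%N; last by lia.
rewrite (_ : 2 * a.+1 + 1 = 3 + 2 * a)%N; last by lia.
rewrite (_ : 2 * a.+1 = 2 + 2 * a)%N; last by lia.
rewrite (_ : 2 * a + 1 = 1 + 2 * a)%N; last by lia.
move: (2 * a)%N => b; rewrite !expnD; move: (3 ^ b)%N => u.
rewrite (_ : 3 ^ 1 = 3)%N // (_ : 3 ^ 2 = 9)%N // (_ : 3 ^ 3 = 27)%N //.
move=> u0 /dvdnP[w def_w].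
have -> : ((9 * u - 1) %/ 4 = w)%N by lia.
have -> : ((9 * (9 * u) - 1) %/ 4 = w + 18 * u)%N by lia.
nia.
Qed.

Theorem theorem3p4 (alpha n : nat) : (1 <= alpha)%N ->
  (((3 ^ (2 * alpha))%N)%:Z %|
     g (3 ^ (2 * alpha - 1) * n + (3 ^ (2 * alpha) - 1) %/ 4)%N)%Z.
Proof.
case: alpha => // a _; have [c [_ vc] E] := gf_iter a.
have -> : (2 * a.+1 - 1 = 2 * a + 1)%N by lia.
rewrite -fcoef_iter E evTE mulr_sumr fcoef_sum; apply: rpred_sum => k _.
rewrite mulrzAr fcoefMz; apply: dvdz_mulr.
by apply: dvdz_trans (vc k); apply: dvdn_exp2l; apply: leq_addr.
Qed.
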